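(* Let $\mathbb{K}$ be a field of characteristic $0$ and let $G$ be a finite abelian group acting diagonally on $V=\mathbb{K}^n$ ($n\ge1$) with respect to a basis $v_1,\dots,v_n$, with ${}^gv_i=\chi_i(g)v_i$. Let $\mathcal{H}_{\mathbf{q},\kappa}$ be a quantum Drinfeld orbifold algebra defined by a parameter function $\kappa:V\times V\to V\otimes\mathbb{K}G$ satisfying the strong vanishing condition. Let $A=\mathbb{Z}^n\times G$, and grade $V$, $G$ and $L=V\otimes\mathbb{K}G$ by $|v_i|=(a_i,1_G)$, $|g|=(0,g)$, $|v_i\otimes g|=|v_i||g|$, where $a_1,\dots,a_n$ is the standard basis of $\mathbb{Z}^n$. Let $N$ be the subgroup of $A$ generated by all $|v_i||v_j||v_r|^{-1}|g|^{-1}$ for which the coefficient of $v_r\otimes g$ in $\kappa(v_i,v_j)$ is nonzero. Use the same symbols $|\cdot|$ for the induced degrees in $A/N$. Then: (a) There exists an antisymmetric bicharacter $\epsilon:A/N\times A/N\to\mathbb{K}^*$ satisfying $$\epsilon(|v_i\otimes g|,|v_j\otimes h|)=q_{ij}\,\chi_j(g)\,\chi_i^{-1}(h)\quad\text{for } g,h\in G,\ 1\le i,j\le n.$$ (b) The space $L=V\otimes\mathbb{K}G$ is an $A/N$-graded algebra under the bilinear operation $[\,,\,]:L\times L\to L$ defined by $$[v_i\otimes g,v_j\otimes h]=\kappa(v_i,{}^gv_j)\,gh\quad\text{for } g,h\in G,\ 1\le i,j\le n,$$ i.e. $[L_a,L_b]\subset L_{ab}$ for all $a,b\in A/N$. (c)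 With this bracket, $L$ is a (graded) Yetter-Drinfeld $(A/N,\epsilon)$-color Lie ring over $\mathbb{K}G$ with universal enveloping algebra $\mathcal{U}(L)$ isomorphic to $\mathcal{H}_{\mathbf{q},\kappa}$.
   Context: Conventions: $\otimes=\otimes_{\mathbb{K}}$; $\mathbb{N}$ contains $0$; $(v\otimes h)g=v\otimes hg$ is right multiplication by $g\in G$ on $V\otimes\mathbb{K}G$. Quantum Drinfeld orbifold algebras. A quantum system of parameters is $\mathbf{q}=\{q_{ij}\}_{1\le i,j\le n}\subset\mathbb{K}^*$ with $q_{ii}=1$, $q_{ji}=q_{ij}^{-1}$. A parameter function is a bilinear map $\kappa:V\times V\to V\otimes\mathbb{K}G$ with $\kappa(v_i,v_j)=-q_{ij}\kappa(v_j,v_i)$. The skew group algebra $T(V)\rtimes G$ is $T(V)\otimes\mathbb{K}G$ with product $(r\,g)(s\,h)=r({}^gs)\,gh$, and $\mathcal{H}_{\mathbf{q},\kappa}=(T(V)\rtimes G)/(v_iv_j-q_{ij}v_jv_i-\kappa(v_i,v_j):1\le i,j\le n)$. It is a quantum Drinfeld orbifold algebra if it satisfies the PBW property: the image of $\{v_1^{m_1}\cdots v_n^{m_n}g:m_i\in\mathbb{N},g\in G\}$ is a $\mathbb{K}$-basis. Strong vanishing condition: for all $g\in G$ and all $1\le i,j,k,r\le n$ (not necessarily distinct), ${}^gv_k=q_{ik}q_{jk}q_{kr}\,v_k$ whenever the coefficient of $v_r\otimes g$ in $\kappa(v_i,v_j)$ is nonzero. Color Lie rings. Let $B$ be an abelian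 group (written multiplicatively). A bicharacter is a map $\epsilon:B\times B\to\mathbb{K}^*$ with $\epsilon(a,bc)=\epsilon(a,b)\epsilon(a,c)$, $\epsilon(ab,c)=\epsilon(a,c)\epsilon(b,c)$; it is antisymmetric if $\epsilon(b,a)=\epsilon(a,b)^{-1}$. Let $R$ be a $B$-graded $\mathbb{K}$-algebra; a $B$-graded $R$-bimodule is an $R$-bimodule $L=\bigoplus_{b\in B}L_b$ with $R_aL_bR_c\subset L_{abc}$. For $0\ne x$ in the degree-$b$ part write $|x|=b$ ($x$ is homogeneous); $|0|=1_B$. A $(B,\epsilon)$-color Lie ring over $R$ is a $B$-graded $R$-bimodule $L$ with an $R$-bilinear, $R$-balanced operation $[\,,\,]:L\times L\to L$ (i.e. $\mathbb{K}$-bilinear with $[rx,ys]=r[x,y]s$ and $[xr,y]=[x,ry]$ for $r,s\in R$) such that for all homogeneous $x,y,z$: $[x,y]\in L_{|x||y|}$; $[x,y]=-\epsilon(|x|,|y|)[y,x]$; and $\epsilon(|z|,|x|)[x,[y,z]]+\epsilon(|x|,|y|)[y,[z,x]]+\epsilon(|y|,|z|)[z,[x,y]]=0$. Its universal enveloping algebra is $\mathcal{U}(L)=T_R(L)/J$, where $T_R(L)=\bigoplus_{m\ge0}L^{\otimes_Rm}$ and $J$ is the ideal generated by all $u\otimes_Rv-\epsilon(|u|,|v|)\,v\otimes_Ru-[u,v]$ with $u,v\in L$ homogeneous. The space $L=V\otimes\mathbb{K}G$ is a $\mathbb{K}G$-bimodule via $g(v\otimes h)g'={}^gv\otimes ghg'$.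 A color Lie ring structure on it over $\mathbb{K}G$ is Yetter-Drinfeld if the grading on $L$ is induced from gradings on $V$ and $G$ (each $g\in G$ homogeneous, $|v\otimes g|=|v||g|$ for homogeneous $v\in V$) and ${}^gv=\epsilon(|g|,|v|)\,v$ for all $g\in G$ and homogeneous $v\in V$. *)

(* Defs.v *)
From HB Require Import structures.
From mathcomp Require Import all_boot all_order all_algebra.
From mathcomp.finmap Require Import finmap.
From mathcomp.multinomials Require Import monalg.
From mathcomp.classical Require Import boolp.

Set Implicit Arguments.
Unset Strict Implicit.
Unset Printing Implicit Defensive.

Import GRing.Theory.
Local Open Scope ring_scope.
Local Open Scope quotient_scope.

(* Abelian groups (the finite group G, the grading groups) are [zmodType]s and
   are therefore written additively: the product ab of the literature is a + b
   and the neutral element is 0. *)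

Section GeneratedSubgroup.

Variables (A : zmodType) (S : A -> Prop).

Inductive in_subgroup : A -> Prop :=
| in_subgroup_gen x of S x : in_subgroup x
| in_subgroup0 : in_subgroup 0
| in_subgroupB x y of in_subgroup x & in_subgroup y : in_subgroup (x - y).

Definition subgroup_gen : {pred A} := fun x => `[< in_subgroup x >].

Lemma subgroup_gen_zmod : zmod_closed subgroup_gen.
Proof.
split; first by apply/asboolP/in_subgroup0.
by move=> x y /asboolP Hx /asboolP Hy; apply/asboolP/in_subgroupB.
Qed.

HB.instance Definition _ := GRing.isZmodClosed.Build A subgroup_gen
  subgroup_gen_zmod.

End GeneratedSubgroup.

(* The quotient of A by the two-sided ideal generated by X. It may be the zero
   ring, so it is a pzRingType and an lmodType but not an [algType]. *)
Section QuotientAlgebra.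

Variables (K : fieldType) (A : algType K) (X : A -> Prop).

Inductive in_ideal : A -> Prop :=
| in_ideal_gen x of X x : in_ideal x
| in_ideal0 : in_ideal 0
| in_idealB x y of in_ideal x & in_ideal y : in_ideal (x - y)
| in_idealMl a x of in_ideal x : in_ideal (a * x)
| in_idealMr a x of in_ideal x : in_ideal (x * a).

Definition ideal_gen : {pred A} := fun x => `[< in_ideal x >].

Lemma ideal_gen_zmod : zmod_closed ideal_gen.
Proof.
split; first by apply/asboolP/in_ideal0.
by move=> x y /asboolP Hx /asboolP Hy; apply/asboolP/in_idealB.
Qed.

HB.instance Definition _ := GRing.isZmodClosed.Build A ideal_gen
  ideal_gen_zmod.

Definition quotalg := Quotient.quot ideal_gen.

HB.instance Definition _ := GRing.Zmodule.on quotalg.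
HB.instance Definition _ := EqQuotient.on quotalg.

Definition quot_pi (x : A) : quotalg := \pi_quotalg x.

Lemma quot_piP x y : quot_pi x = quot_pi y <-> in_ideal (x - y).
Proof.
rewrite /quot_pi; split=> [/eqP|H].
  by rewrite -Quotient.idealrBE => /asboolP.
by apply/eqP; rewrite -Quotient.idealrBE; apply/asboolP.
Qed.

Lemma quot_piK (x : quotalg) : quot_pi (repr x) = x.
Proof. exact: reprK. Qed.

Lemma quot_piD x y : quot_pi (x + y) = quot_pi x + quot_pi y.
Proof. by rewrite /quot_pi !piE. Qed.

Definition quotalg_one : quotalg := quot_pi 1.
Definition quotalg_mul (x y : quotalg) : quotalg := quot_pi (repr x * repr y).
Definition quotalg_scale (k : K) (x : quotalg) : quotalg :=
  quot_pi (k *: repr x).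

Lemma quot_piM x y : quotalg_mul (quot_pi x) (quot_pi y) = quot_pi (x * y).
Proof.
apply/quot_piP; set x' := repr _; set y' := repr _.
have Hx : in_ideal (x' - x) by apply/quot_piP; rewrite quot_piK.
have Hy : in_ideal (y' - y) by apply/quot_piP; rewrite quot_piK.
have -> : x' * y' - x * y = (x' - x) * y' - x * (y - y').
  by rewrite mulrBl mulrBr opprB addrA subrK.
apply: in_idealB; first exact: in_idealMr.
apply: in_idealMl; rewrite -opprB -sub0r.
by apply: in_idealB => //; apply: in_ideal0.
Qed.

Lemma quot_piZ k x : quotalg_scale k (quot_pi x) = quot_pi (k *: x).
Proof.
apply/quot_piP; set x' := repr _.
have Hx : in_ideal (x' - x) by apply/quot_piP; rewrite quot_piK.
by rewrite -scalerBr -[x' - x]mul1r scalerAl; apply: in_idealMl.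
Qed.

Fact quotalg_mulA : associative quotalg_mul.
Proof.
move=> x y z; rewrite -[x]quot_piK -[y]quot_piK -[z]quot_piK.
by rewrite !quot_piM mulrA.
Qed.

Fact quotalg_mul1 : left_id quotalg_one quotalg_mul.
Proof. by move=> x; rewrite -[x]quot_piK quot_piM mul1r. Qed.

Fact quotalg_mulr1 : right_id quotalg_one quotalg_mul.
Proof. by move=> x; rewrite -[x]quot_piK quot_piM mulr1. Qed.

Fact quotalg_mulDl : left_distributive quotalg_mul +%R.
Proof.
move=> x y z; rewrite -[x]quot_piK -[y]quot_piK -[z]quot_piK.
by rewrite -quot_piD !quot_piM mulrDl quot_piD.
Qed.

Fact quotalg_mulDr : right_distributive quotalg_mul +%R.
Proof.
move=> x y z; rewrite -[x]quot_piK -[y]quot_piK -[z]quot_piK.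
by rewrite -quot_piD !quot_piM mulrDr quot_piD.
Qed.

HB.instance Definition _ := GRing.Zmodule_isPzRing.Build quotalg
  quotalg_mulA quotalg_mul1 quotalg_mulr1 quotalg_mulDl quotalg_mulDr.

Fact quotalg_scalerA k l x :
  quotalg_scale k (quotalg_scale l x) = quotalg_scale (k * l) x.
Proof. by rewrite -[x]quot_piK !quot_piZ scalerA. Qed.

Fact quotalg_scale1r : left_id 1 quotalg_scale.
Proof. by move=> x; rewrite -[x]quot_piK quot_piZ scale1r. Qed.

Fact quotalg_scalerDr : right_distributive quotalg_scale +%R.
Proof.
move=> k x y; rewrite -[x]quot_piK -[y]quot_piK.
by rewrite -quot_piD !quot_piZ scalerDr quot_piD.
Qed.

Fact quotalg_scalerDl x : {morph quotalg_scale^~ x : k l / k + l}.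
Proof. by move=> k l; rewrite -[x]quot_piK !quot_piZ scalerDl quot_piD. Qed.

HB.instance Definition _ := GRing.Zmodule_isLmodule.Build K quotalg
  quotalg_scalerA quotalg_scale1r quotalg_scalerDr quotalg_scalerDl.

Lemma quot_mulE x y : quot_pi x * quot_pi y = quot_pi (x * y).
Proof. exact: quot_piM. Qed.

Lemma quot_scaleE k x : k *: quot_pi x = quot_pi (k *: x).
Proof. exact: quot_piZ. Qed.

Fact quotalg_scalerAl (k : K) (x y : quotalg) : k *: (x * y) = (k *: x) * y.
Proof.
by rewrite -[x]quot_piK -[y]quot_piK quot_mulE !quot_scaleE quot_mulE scalerAl.
Qed.

Fact quotalg_scalerAr (k : K) (x y : quotalg) : k *: (x * y) = x * (k *: y).
Proof.
by rewrite -[x]quot_piK -[y]quot_piK quot_mulE !quot_scaleE quot_mulE scalerAr.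
Qed.

End QuotientAlgebra.

(* Data for a twisted monoid algebra: a monoid with a K-valued 2-cocycle. *)
Record twmonoid (K : fieldType) := TwMonoid {
  tw_sort :> choiceType;
  tw_one : tw_sort;
  tw_mul : tw_sort -> tw_sort -> tw_sort;
  tw_coc : tw_sort -> tw_sort -> K;
  tw_mulA : associative tw_mul;
  tw_mul1 : left_id tw_one tw_mul;
  tw_mulr1 : right_id tw_one tw_mul;
  tw_cocA : forall a b c,
    tw_coc b c * tw_coc a (tw_mul b c) = tw_coc a b * tw_coc (tw_mul a b) c;
  tw_coc1 : forall a, tw_coc tw_one a = 1;
  tw_cocr1 : forall a, tw_coc a tw_one = 1
}.

Section LinearExtension.

Variables (K : fieldType) (M : choiceType) (V : lmodType K).

Definition lin_ext (h : M -> V) (f : {malg K[M]}) : V :=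
  \sum_(a <- msupp f) f@_a *: h a.

Lemma lin_extw h f (d : {fset M}) : (msupp f `<=` d)%fset ->
  lin_ext h f = \sum_(a <- d) f@_a *: h a.
Proof.
move=> led; rewrite /lin_ext (big_fset_incl _ led) //= => a _ af.
by rewrite mcoeff_outdom // scale0r.
Qed.

Lemma lin_ext_linear h : linear (lin_ext h).
Proof.
move=> k f g; pose d := (msupp (k *: f + g) `|` (msupp f `|` msupp g))%fset.
have [d1 d2 d3] : [/\ msupp (k *: f + g) `<=` d, msupp f `<=` d
    & msupp g `<=` d]%fset.
  by split; apply/fsubsetP => x xs; rewrite !inE xs ?orbT.
rewrite (lin_extw h d1) (lin_extw h d2) (lin_extw h d3).
rewrite scaler_sumr -big_split /=; apply: eq_bigr => a _.
by rewrite mcoeffD mcoeffZ scalerDl scalerA.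
Qed.

Lemma lin_extU h a : lin_ext h << a >> = h a.
Proof.
rewrite /lin_ext msuppU oner_eq0 big_seq_fset1 mcoeffUU scale1r //.
Qed.

Lemma lin_extP (f g : {malg K[M]} -> V) : linear f -> linear g ->
  (forall a, f << a >> = g << a >>) -> f =1 g.
Proof.
move=> lf lg fg x.
have z (f' : {malg K[M]} -> V) : linear f' -> f' 0 = 0.
  move=> lf'; have := lf' (-1) 0 0.
  by rewrite scaler0 addr0 scaleN1r addNr.
have -> : x = \sum_(a <- msupp x) x@_a *: (<< a >> : {malg K[M]}).
  rewrite {1}[x]monalgE; apply: eq_bigr => a _; apply/malgP => b.
  by rewrite mcoeffZ !mcoeffU mulrnAr mulr1.
elim: (enum_fset _) => [|a s IH]; first by rewrite !big_nil !z.
by rewrite !big_cons lf lg fg IH.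
Qed.

End LinearExtension.

(* The algebra with K-basis M and product << a >> << b >> = c(a,b) << ab >>. *)
Definition twalg (K : fieldType) (M : twmonoid K) := {malg K[M]}.

Section TwistedMonoidAlgebra.

Variables (K : fieldType) (M : twmonoid K).

HB.instance Definition _ := GRing.Lmodule.on (twalg M).

Implicit Types f g h : twalg M.

Definition twalg_one : twalg M := << tw_one M >>.
Definition twalg_mul f g : twalg M :=
  lin_ext (fun a =>
    lin_ext (fun b => tw_coc a b *: (<< tw_mul a b >> : twalg M)) g) f.

Fact twalg_mull g : linear (twalg_mul^~ g).
Proof. exact: lin_ext_linear. Qed.

Fact twalg_mulr f : linear (twalg_mul f).
Proof.
have mE x : twalg_mul f x = \sum_(a <- msupp f) f@_a *:
    lin_ext (fun b => tw_coc a b *: (<< tw_mul a b >> : twalg M)) x by [].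
move=> k g h; rewrite !mE scaler_sumr -big_split /=.
by apply: eq_bigr => a _; rewrite lin_ext_linear scalerDr !scalerA mulrC.
Qed.

Fact twalg_mulU (a b : M) : twalg_mul << a >> << b >> =
  tw_coc a b *: (<< tw_mul a b >> : twalg M).
Proof. by rewrite /twalg_mul !lin_extU. Qed.

Fact twalg_mulZl k f g : twalg_mul (k *: f) g = k *: twalg_mul f g.
Proof.
have z : twalg_mul 0 g = 0 by rewrite /twalg_mul /lin_ext msupp0 big_nil.
by rewrite -[k *: f]addr0 twalg_mull z addr0.
Qed.

Fact twalg_mulZr k f g : twalg_mul f (k *: g) = k *: twalg_mul f g.
Proof.
have z : twalg_mul f 0 = 0.
  by have := twalg_mulr f (-1) 0 0; rewrite scaler0 addr0 scaleN1r addNr.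
by rewrite -[k *: g]addr0 twalg_mulr z addr0.
Qed.

Fact twalg_mulDl : left_distributive twalg_mul +%R.
Proof. by move=> f g h; rewrite -[f]scale1r twalg_mull !scale1r. Qed.

Fact twalg_mulDr : right_distributive twalg_mul +%R.
Proof. by move=> f g h; rewrite -[g]scale1r twalg_mulr !scale1r. Qed.

Fact twalg_mulA : associative twalg_mul.
Proof.
move=> f g h; move: f; apply: lin_extP => [k x y|k x y|a].
- by rewrite twalg_mull.
- by rewrite !twalg_mull.
move: g; apply: lin_extP => [k x y|k x y|b].
- by rewrite twalg_mull twalg_mulr.
- by rewrite twalg_mulr twalg_mull.
move: h; apply: lin_extP => [k x y|k x y|c].
- by rewrite !twalg_mulr.
- by rewrite twalg_mulr.
rewrite !twalg_mulU twalg_mulZl twalg_mulZr !twalg_mulU !scalerA tw_mulA.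
by rewrite tw_cocA.
Qed.

Fact twalg_mul1 : left_id twalg_one twalg_mul.
Proof.
apply: lin_extP => [k x y|k x y|a] //; first by rewrite twalg_mulr.
by rewrite twalg_mulU tw_coc1 tw_mul1 scale1r.
Qed.

Fact twalg_mulr1 : right_id twalg_one twalg_mul.
Proof.
apply: lin_extP => [k x y|k x y|a] //; first by rewrite twalg_mull.
by rewrite twalg_mulU tw_cocr1 tw_mulr1 scale1r.
Qed.

Fact twalg_oner_neq0 : twalg_one != 0.
Proof. by rewrite monalgU_eq0 oner_neq0. Qed.

HB.instance Definition _ := GRing.Zmodule_isNzRing.Build (twalg M)
  twalg_mulA twalg_mul1 twalg_mulr1 twalg_mulDl twalg_mulDr twalg_oner_neq0.

Fact twalg_scalerAl k f g : k *: (f * g) = (k *: f) * g.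
Proof. by rewrite [RHS]twalg_mulZl. Qed.

HB.instance Definition _ := GRing.Lmodule_isLalgebra.Build K (twalg M)
  twalg_scalerAl.

Fact twalg_scalerAr k f g : k *: (f * g) = f * (k *: g).
Proof. by rewrite [RHS]twalg_mulZr. Qed.

HB.instance Definition _ := GRing.Lalgebra_isAlgebra.Build K (twalg M)
  twalg_scalerAr.

Lemma twalgMU (a b : M) : (<< a >> : twalg M) * (<< b >> : twalg M) =
  tw_coc a b *: (<< tw_mul a b >> : twalg M).
Proof. exact: twalg_mulU. Qed.

End TwistedMonoidAlgebra.

HB.mixin Record isBimodule (K : fieldType) (R : algType K) L
    of GRing.Lmodule K L := {
  lact : R -> L -> L;
  ract : L -> R -> L;
  lact_linearl : forall x, linear (lact^~ x);
  lact_linearr : forall r, linear (lact r);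
  ract_linearl : forall r, linear (ract^~ r);
  ract_linearr : forall x, linear (ract x);
  lact1 : forall x, lact 1 x = x;
  ract1 : forall x, ract x 1 = x;
  lactM : forall r s x, lact (r * s) x = lact r (lact s x);
  ractM : forall x r s, ract x (r * s) = ract (ract x r) s;
  lractA : forall r x s, ract (lact r x) s = lact r (ract x s)
}.

#[short(type="bimodType")]
HB.structure Definition Bimodule (K : fieldType) (R : algType K) :=
  {L of isBimodule K R L & GRing.Lmodule K L}.

(* The tensor algebra T_R(L) is the direct sum over m of the L^(m), where L^(m),
   the m-fold tensor power of L over R, is presented as the K-vector space
   spanned by symbols ([:: l_1; ...; l_m], r), which stand for
   l_1 (x) ... (x) l_m r, modulo K-multilinearity and R-balancedness. The slot
   r gives L^(0) = R and is redundant for m > 0. The symbols form a monoid, and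
   the relations span an ideal of its monoid algebra (tensor_rel_ideal), so that
   the quotient by the ideal they generate adds no further relation. *)
Section TensorAlgebra.

Variables (K : fieldType) (R : algType K) (L : bimodType R).

Definition tsym := (seq L * R)%type.

Definition tsym_mul (x y : tsym) : tsym :=
  if y.1 is l :: w then (x.1 ++ lact x.2 l :: w, y.2) else (x.1, x.2 * y.2).

Fact tsym_mulA : associative tsym_mul.
Proof.
case=> [w r] [[|l w'] r'] [[|l' w''] r''] //=; rewrite /tsym_mul /=.
- by rewrite mulrA.
- by rewrite lactM.
- by rewrite -catA.
Qed.

Fact tsym_mul1 : left_id ([::], 1) tsym_mul.
Proof. by case=> [[|l w] r]; rewrite /tsym_mul /= ?mul1r ?lact1. Qed.

Fact tsym_mulr1 : right_id ([::], 1) tsym_mul.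
Proof. by case=> w r; rewrite /tsym_mul /= mulr1. Qed.

Definition tsym_monoid : twmonoid K :=
  @TwMonoid K tsym ([::], 1) tsym_mul (fun _ _ => 1)
    tsym_mulA tsym_mul1 tsym_mulr1
    (fun _ _ _ => erefl) (fun _ => erefl) (fun _ => erefl).

Local Notation pre := (twalg tsym_monoid).

Definition tsymb (w : seq L) (r : R) : pre := << ((w, r) : tsym_monoid) >>.

Inductive tensor_rel : pre -> Prop :=
| tensor_rel_scal w k r s :
    tensor_rel (tsymb w (k *: r + s) - k *: tsymb w r - tsymb w s)
| tensor_rel_lin w1 k l l' w2 r :
    tensor_rel (tsymb (w1 ++ (k *: l + l') :: w2) r
                - k *: tsymb (w1 ++ l :: w2) r - tsymb (w1 ++ l' :: w2) r)
| tensor_rel_bal w1 l s l' w2 r :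
    tensor_rel (tsymb (w1 ++ ract l s :: l' :: w2) r
                - tsymb (w1 ++ l :: lact s l' :: w2) r)
| tensor_rel_last w l s r :
    tensor_rel (tsymb (rcons w (ract l s)) r - tsymb (rcons w l) (s * r)).

Definition tensor_alg := quotalg tensor_rel.
HB.instance Definition _ := GRing.PzRing.on tensor_alg.
HB.instance Definition _ := GRing.Lmodule.on tensor_alg.

Inductive in_span (X : pre -> Prop) : pre -> Prop :=
| in_span0 : in_span X 0
| in_spanD k x y of X x & in_span X y : in_span X (k *: x + y).

Lemma in_spanDr X x y : in_span X x -> in_span X y -> in_span X (x + y).
Proof.
move=> Hx Hy; elim: Hx => [|k u v Xu _ IH]; first by rewrite add0r.
by rewrite -addrA; apply: in_spanD.
Qed.

Lemma in_spanZ X k x : in_span X x -> in_span X (k *: x).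
Proof.
elim=> [|l u v Xu _ IH]; first by rewrite scaler0; apply: in_span0.
by rewrite scalerDr scalerA; apply: in_spanD.
Qed.

Lemma in_span_gen (X : pre -> Prop) x : X x -> in_span X x.
Proof.
by move=> Xx; rewrite -[x]scale1r -[_ *: _]addr0; apply: in_spanD => //;
  apply: in_span0.
Qed.

Lemma tsymbM w r w' r' : tsymb w r * tsymb w' r' =
  tsymb (tsym_mul (w, r) (w', r')).1 (tsym_mul (w, r) (w', r')).2.
Proof. by rewrite /tsymb twalgMU /= scale1r; case: tsym_mul. Qed.

Lemma tensor_rel_mull w r x : tensor_rel x -> tensor_rel (tsymb w r * x).
Proof.
case=> [w' k s s'|[|l0 w1] k l l' w2 s|[|l0 w1] l s l' w2 s'|[|l0 w'] l s s'];
  rewrite ?rcons_cons /= ?mulrBr -?scalerAr ?tsymbM /tsym_mul /=.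
- case: w' => [|l w']; last exact: tensor_rel_scal.
  rewrite mulrDr -scalerAr; exact: tensor_rel_scal.
- rewrite lact_linearr; exact: tensor_rel_lin.
- rewrite -!cat_cons !catA; exact: tensor_rel_lin.
- rewrite -lractA; exact: tensor_rel_bal.
- rewrite -!cat_cons !catA; exact: tensor_rel_bal.
- rewrite -lractA !cats1; exact: tensor_rel_last.
- rewrite -!rcons_cons -!rcons_cat; exact: tensor_rel_last.
Qed.

Lemma tensor_rel_mulr w r x : tensor_rel x ->
  in_span tensor_rel (x * tsymb w r).
Proof.
move=> Hx; apply: in_span_gen.
case: Hx => [w' k s s'|w1 k l l' w2 s|w1 l s l' w2 s'|w' l s s'];
  rewrite ?mulrBl -?scalerAl ?tsymbM /tsym_mul /=; case: w => [|l0 w] /=.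
- rewrite mulrDl -scalerAl; exact: tensor_rel_scal.
- rewrite lact_linearl; exact: tensor_rel_lin.
- exact: tensor_rel_lin.
- rewrite -!catA /=; exact: tensor_rel_lin.
- exact: tensor_rel_bal.
- rewrite -!catA /=; exact: tensor_rel_bal.
- rewrite -mulrA; exact: tensor_rel_last.
- rewrite -!cats1 -!catA /= lactM; exact: tensor_rel_bal.
Qed.

Lemma pre_ind (P : pre -> Prop) : P 0 ->
  (forall k w r x, P x -> P (k *: tsymb w r + x)) -> forall x, P x.
Proof.
move=> P0 PD x; rewrite [x]monalgE; elim: (enum_fset _) => [|[w r] s IH].
  by rewrite big_nil.
rewrite big_cons; suff -> : << x@_(w, r) *g ((w, r) : tsym_monoid) >> =
  x@_(w, r) *: tsymb w r :> pre by apply: PD.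
by apply/malgP => b; rewrite mcoeffZ !mcoeffU mulrnAr mulr1.
Qed.

Lemma tensor_rel_ideal x : in_ideal tensor_rel x <-> in_span tensor_rel x.
Proof.
split; last first.
  elim=> [|k u v Xu _ IH]; first exact: in_ideal0.
  rewrite -[v]opprK; apply: in_idealB.
    by rewrite -[u]mul1r scalerAl; apply/in_idealMl/in_ideal_gen.
  by rewrite -sub0r; apply: in_idealB => //; apply: in_ideal0.
elim=> {x} [x|||a x _ Sx|a x _ Sx]; first exact: in_span_gen.
- exact: in_span0.
- move=> x y _ Sx _ Sy; rewrite -scaleN1r; apply: in_spanDr => //.
  exact: in_spanZ.
- elim/pre_ind: a => [|k w r a IH]; first by rewrite mul0r; apply: in_span0.
  rewrite mulrDl; apply: in_spanDr IH; rewrite -scalerAl.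
  apply: in_spanZ; elim: Sx => [|l u v Xu _ IHv].
    by rewrite mulr0; apply: in_span0.
  rewrite mulrDr -scalerAr; apply: in_spanD => //; exact: tensor_rel_mull.
- elim/pre_ind: a => [|k w r a IH]; first by rewrite mulr0; apply: in_span0.
  rewrite mulrDr; apply: in_spanDr IH.
  have -> : x * (k *: tsymb w r) = k *: (x * tsymb w r) by rewrite scalerAr.
  apply: in_spanZ; elim: Sx => [|l u v Xu _ IHv].
    by rewrite mul0r; apply: in_span0.
  rewrite mulrDl -scalerAl; apply: in_spanDr => //; apply: in_spanZ.
  exact: tensor_rel_mulr.
Qed.

Definition deg0_part (x : pre) : R :=
  lin_ext (fun t => if t.1 is [::] then t.2 else 0) x.

Fact tensor_alg_oner_neq0 : (1 : tensor_alg) != 0.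
Proof.
apply/eqP => e; have : in_ideal tensor_rel (1 - 0 : pre).
  by apply/quot_piP; rewrite -[LHS]/(1 : tensor_alg) e /quot_pi !piE.
move/tensor_rel_ideal; rewrite subr0 => H.
have lin : linear deg0_part by apply: lin_ext_linear.
have d0 : deg0_part 0 = 0 by rewrite /deg0_part /lin_ext msupp0 big_nil.
suff /eqP : deg0_part 1 = 0 by rewrite /deg0_part lin_extU oner_eq0.
have linZ k (x : pre) : deg0_part (k *: x) = k *: deg0_part x.
  by have := lin k x 0; rewrite addr0 d0 addr0.
have linB x y : deg0_part (x - y) = deg0_part x - deg0_part y.
  by rewrite addrC -scaleN1r lin scaleN1r addrC.
elim: H => // k x y + _ IH; rewrite lin IH addr0 => Hx.
suff -> : deg0_part x = 0 by rewrite scaler0.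
case: Hx => [w l r s|w1 l x1 x2 w2 r|w1 x1 s x2 w2 r|w x1 r s];
  rewrite !linB ?linZ /deg0_part !lin_extU /=.
- case: w => [|? ?]; last by rewrite scaler0 !subr0.
  by rewrite -addrA -opprD subrr.
- by case: w1 => [|? ?] /=; rewrite scaler0 !subr0.
- by case: w1 => [|? ?] /=; rewrite subr0.
- by case: w => [|? ?] /=; rewrite subr0.
Qed.

HB.instance Definition _ := GRing.PzSemiRing_isNonZero.Build tensor_alg
  tensor_alg_oner_neq0.
HB.instance Definition _ := GRing.Lmodule_isLalgebra.Build K tensor_alg
  (@quotalg_scalerAl K pre tensor_rel).
HB.instance Definition _ := GRing.Lalgebra_isAlgebra.Build K tensor_alg
  (@quotalg_scalerAr K pre tensor_rel).

Definition tensor_in (l : L) : tensor_alg := quot_pi tensor_rel (tsymb [:: l] 1).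

End TensorAlgebra.

Section Gradings.

Variables (K : fieldType) (B : zmodType).

(* [gr b] is the degree-b component; the sum of the components is direct. *)
Definition is_grading (M : lmodType K) (gr : B -> M -> Prop) : Prop :=
  [/\ forall b, gr b 0,
      forall b (k : K) x y, gr b x -> gr b y -> gr b (k *: x + y),
      forall x, exists (s : seq B) (f : B -> M),
        (forall b, gr b (f b)) /\ x = \sum_(b <- s) f b
    & forall (s : seq B) (f : B -> M), uniq s -> (forall b, gr b (f b)) ->
        \sum_(b <- s) f b = 0 -> {in s, forall b, f b = 0}].

Definition graded_algebra (R : algType K) (grR : B -> R -> Prop) : Prop :=
  [/\ is_grading grR, grR 0 1
    & forall a b r s, grR a r -> grR b s -> grR (a + b) (r * s)].

Definition graded_bimodule (R : algType K) (grR : B -> R -> Prop)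
    (L : bimodType R) (grL : B -> L -> Prop) : Prop :=
  is_grading grL /\
  forall a b c r x s, grR a r -> grL b x -> grR c s ->
    grL (a + b + c) (ract (lact r x) s).

Definition bicharacter (eps : B -> B -> K) : Prop :=
  [/\ forall a b, eps a b != 0,
      forall a b c, eps a (b + c) = eps a b * eps a c
    & forall a b c, eps (a + b) c = eps a c * eps b c].

Definition antisymmetric_bichar (eps : B -> B -> K) : Prop :=
  forall a b, eps b a = (eps a b)^-1.

(* The zero vector lies in every component; the homogeneous identities are
   trivial for it whatever degree it is given. *)
Record color_Lie_ring (eps : B -> B -> K) (R : algType K)
    (grR : B -> R -> Prop) (L : bimodType R) (grL : B -> L -> Prop)
    (br : L -> L -> L) : Prop := ColorLieRing {
  clr_ring : graded_algebra grR;
  clr_bimod : graded_bimodule grR grL;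
  clr_linl : forall y, linear (br^~ y);
  clr_linr : forall x, linear (br x);
  clr_bilin : forall r x y s,
    br (lact r x) (ract y s) = ract (lact r (br x y)) s;
  clr_bal : forall x r y, br (ract x r) y = br x (lact r y);
  clr_deg : forall a b x y, grL a x -> grL b y -> grL (a + b) (br x y);
  clr_anti : forall a b x y, grL a x -> grL b y ->
    br x y = - (eps a b *: br y x);
  clr_jacobi : forall a b c x y z, grL a x -> grL b y -> grL c z ->
    eps c a *: br x (br y z) + eps a b *: br y (br z x)
      + eps b c *: br z (br x y) = 0
}.

Definition env_rel (eps : B -> B -> K) (R : algType K) (L : bimodType R)
    (grL : B -> L -> Prop) (br : L -> L -> L) (t : tensor_alg L) : Prop :=
  exists (a b : B) (u v : L), [/\ grL a u, grL b v
    & t = tensor_in u * tensor_in v - eps a b *: (tensor_in v * tensor_in u)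
          - tensor_in (br u v)].

Definition universal_env (eps : B -> B -> K) (R : algType K) (L : bimodType R)
    (grL : B -> L -> Prop) (br : L -> L -> L) := quotalg (env_rel eps grL br).
HB.instance Definition _ eps R L grL br :=
  GRing.PzRing.on (@universal_env eps R L grL br).
HB.instance Definition _ eps R L grL br :=
  GRing.Lmodule.on (@universal_env eps R L grL br).

End Gradings.

Record diag_action (K : fieldType) (n : nat) (G : finZmodType) := DiagAction {
  chi :> 'I_n -> G -> K;
  chi0 : forall i, chi i 0 = 1;
  chiD : forall i g h, chi i (g + h) = chi i g * chi i h
}.

Definition bvec (K : fieldType) (n : nat) (i : 'I_n) : 'rV[K]_n := delta_mx 0 i.
Arguments bvec {K n} i.

Section DiagonalAction.

Variables (K : fieldType) (n : nat) (G : finZmodType).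
Variable c : diag_action K n G.

Local Notation V := 'rV[K]_n.

Definition gact (g : G) (v : V) : V := \row_i (c i g * v 0 i).

Lemma gact_linear g : linear (gact g).
Proof.
by move=> k u v; apply/rowP => i; rewrite !mxE mulrDr !mulrA (mulrC k).
Qed.

Lemma gact0 v : gact 0 v = v.
Proof. by apply/rowP => i; rewrite !mxE chi0 mul1r. Qed.

Lemma gactD g h v : gact (g + h) v = gact g (gact h v).
Proof. by apply/rowP => i; rewrite !mxE chiD mulrA. Qed.

Definition group_monoid : twmonoid K :=
  @TwMonoid K G 0 +%R (fun _ _ => 1) (@addrA G) (@add0r G) (@addr0 G)
    (fun _ _ _ => erefl) (fun _ => erefl) (fun _ => erefl).

Definition KG := twalg group_monoid.
HB.instance Definition _ := GRing.Algebra.on KG.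

Definition gelt (g : G) : KG := << (g : group_monoid) >>.

(* T(V) has the words in v_1, ..., v_n as a basis, so T(V) # G has the basis of
   pairs (w, g), multiplied by (w g)(w' h) = w (^g w') gh. *)
Definition skew_mul (x y : seq 'I_n * G) : seq 'I_n * G :=
  (x.1 ++ y.1, x.2 + y.2).

Definition skew_coc (x y : seq 'I_n * G) : K := \prod_(i <- y.1) c i x.2.

Fact skew_mulA : associative skew_mul.
Proof. by move=> x y z; rewrite /skew_mul /= catA addrA. Qed.

Fact skew_mul1 : left_id ([::], 0) skew_mul.
Proof. by case=> w g; rewrite /skew_mul /= add0r. Qed.

Fact skew_mulr1 : right_id ([::], 0) skew_mul.
Proof. by case=> w g; rewrite /skew_mul /= cats0 addr0. Qed.

Fact skew_cocA x y z : skew_coc y z * skew_coc x (skew_mul y z) =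
  skew_coc x y * skew_coc (skew_mul x y) z.
Proof.
rewrite /skew_coc /= big_cat /= mulrCA; congr (_ * _).
by rewrite mulrC -big_split; apply: eq_bigr => i _; rewrite /= chiD.
Qed.

Fact skew_coc1 x : skew_coc ([::], 0) x = 1.
Proof. by rewrite /skew_coc big1 // => i _; rewrite chi0. Qed.

Fact skew_cocr1 x : skew_coc x ([::], 0) = 1.
Proof. by rewrite /skew_coc big_nil. Qed.

Definition skew_monoid : twmonoid K :=
  @TwMonoid K (seq 'I_n * G)%type ([::], 0) skew_mul skew_coc
    skew_mulA skew_mul1 skew_mulr1 skew_cocA skew_coc1 skew_cocr1.

Definition TVG := twalg skew_monoid.
HB.instance Definition _ := GRing.Algebra.on TVG.

Definition skew_elt (w : seq 'I_n) (g : G) : TVG := << ((w, g) : skew_monoid) >>.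

(* V (x) KG; [x g 0 r] is the coefficient of v_r (x) g in x. *)
Definition VG of diag_action K n G := {ffun G -> V}.
Local Notation L := (VG c).
HB.instance Definition _ := GRing.Lmodule.on L.

Definition tens (v : V) (g : G) : L := [ffun h => if h == g then v else 0].

Definition VG_lact (r : KG) (x : L) : L :=
  [ffun k => \sum_(g : G) r@_g *: gact g (x (k - g))].

Definition VG_ract (x : L) (r : KG) : L :=
  [ffun k => \sum_(g : G) r@_g *: x (k - g)].

Lemma gact_0 g : gact g 0 = 0.
Proof. by apply/rowP => i; rewrite !mxE mulr0. Qed.

Lemma gactZ g k v : gact g (k *: v) = k *: gact g v.
Proof. by rewrite -[k *: v]addr0 gact_linear gact_0 addr0. Qed.

Lemma VG_lact_linearl x : linear (VG_lact^~ x).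
Proof.
move=> k r s; apply/ffunP => h; rewrite !ffunE scaler_sumr -big_split /=.
by apply: eq_bigr => g _; rewrite mcoeffD mcoeffZ scalerDl scalerA.
Qed.

Lemma VG_lact_linearr r : linear (VG_lact r).
Proof.
move=> k x y; apply/ffunP => h; rewrite !ffunE scaler_sumr -big_split /=.
apply: eq_bigr => g _.
by rewrite !ffunE gact_linear scalerDr !scalerA mulrC.
Qed.

Lemma VG_ract_linearl r : linear (VG_ract^~ r).
Proof.
move=> k x y; apply/ffunP => h; rewrite !ffunE scaler_sumr -big_split /=.
by apply: eq_bigr => g _; rewrite !ffunE scalerDr !scalerA mulrC.
Qed.

Lemma VG_ract_linearr x : linear (VG_ract x).
Proof.
move=> k r s; apply/ffunP => h; rewrite !ffunE scaler_sumr -big_split /=.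
by apply: eq_bigr => g _; rewrite mcoeffD mcoeffZ scalerDl scalerA.
Qed.

Lemma VG_lact_gelt g x : VG_lact (gelt g) x = [ffun k => gact g (x (k - g))].
Proof.
apply/ffunP => k; rewrite !ffunE (bigD1 g) //= mcoeffUU scale1r big1 ?addr0 //.
by move=> h hg; rewrite mcoeffU eq_sym (negPf hg) scale0r.
Qed.

Lemma VG_ract_gelt g x : VG_ract x (gelt g) = [ffun k => x (k - g)].
Proof.
apply/ffunP => k; rewrite !ffunE (bigD1 g) //= mcoeffUU scale1r big1 ?addr0 //.
by move=> h hg; rewrite mcoeffU eq_sym (negPf hg) scale0r.
Qed.

Lemma VG_lact1 x : VG_lact 1 x = x.
Proof.
by rewrite VG_lact_gelt; apply/ffunP => k; rewrite ffunE gact0 subr0.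
Qed.

Lemma VG_ract1 x : VG_ract x 1 = x.
Proof. by rewrite VG_ract_gelt; apply/ffunP => k; rewrite ffunE subr0. Qed.

Lemma geltM g h : gelt g * gelt h = gelt (g + h).
Proof. by rewrite /gelt [LHS]twalgMU scale1r. Qed.

Lemma KG_linP (f f' : KG -> L) : linear f -> linear f' ->
  (forall g, f (gelt g) = f' (gelt g)) -> f =1 f'.
Proof. exact: lin_extP. Qed.

Lemma VG_lactM r s x : VG_lact (r * s) x = VG_lact r (VG_lact s x).
Proof.
move: r; apply: KG_linP => [k r r'|k r r'|g].
- by rewrite mulrDl -scalerAl VG_lact_linearl.
- by rewrite VG_lact_linearl.
move: s; apply: KG_linP => [k r r'|k r r'|h].
- by rewrite mulrDr -scalerAr VG_lact_linearl.
- by rewrite VG_lact_linearl VG_lact_linearr.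
rewrite geltM !VG_lact_gelt; apply/ffunP => k; rewrite !ffunE gactD.
by rewrite opprD addrA.
Qed.

Lemma VG_ractM x r s : VG_ract x (r * s) = VG_ract (VG_ract x r) s.
Proof.
move: r; apply: KG_linP => [k r r'|k r r'|g].
- by rewrite mulrDl -scalerAl VG_ract_linearr.
- by rewrite VG_ract_linearr VG_ract_linearl.
move: s; apply: KG_linP => [k r r'|k r r'|h].
- by rewrite mulrDr -scalerAr VG_ract_linearr.
- by rewrite VG_ract_linearr.
rewrite geltM !VG_ract_gelt; apply/ffunP => k; rewrite !ffunE.
by rewrite opprD addrA addrAC.
Qed.

Lemma VG_lractA r x s : VG_ract (VG_lact r x) s = VG_lact r (VG_ract x s).
Proof.
move: r; apply: KG_linP => [k r r'|k r r'|g].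
- by rewrite VG_lact_linearl VG_ract_linearl.
- by rewrite VG_lact_linearl.
move: s; apply: KG_linP => [k r r'|k r r'|h].
- by rewrite VG_ract_linearr.
- by rewrite VG_ract_linearr VG_lact_linearr.
rewrite !VG_ract_gelt !VG_lact_gelt; apply/ffunP => k; rewrite !ffunE.
by rewrite addrAC.
Qed.

HB.instance Definition _ := isBimodule.Build K KG L
  VG_lact_linearl VG_lact_linearr VG_ract_linearl VG_ract_linearr
  VG_lact1 VG_ract1 VG_lactM VG_ractM VG_lractA.

Lemma lact_ract_tens g v h g' :
  ract (lact (gelt g) (tens v h)) (gelt g') = tens (gact g v) (g + h + g').
Proof.
rewrite [lact _ _]VG_lact_gelt [ract _ _]VG_ract_gelt.
apply/ffunP => k; rewrite !ffunE !subr_eq [h + g]addrC.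
by case: eqP => // _; rewrite gact_0.
Qed.

Definition VG_in (x : L) : TVG :=
  \sum_(g : G) \sum_(r < n) x g 0 r *: skew_elt [:: r] g.

End DiagonalAction.

Definition quantum_params (K : fieldType) (n : nat) (q : 'I_n -> 'I_n -> K) :
    Prop :=
  [/\ forall i j, q i j != 0, forall i, q i i = 1
    & forall i j, q j i = (q i j)^-1].

Section DrinfeldOrbifold.

Variables (K : fieldType) (n : nat) (G : finZmodType).
Variable c : diag_action K n G.
Variable q : 'I_n -> 'I_n -> K.
Variable kappa : 'rV[K]_n -> 'rV[K]_n -> VG c.

Definition parameter_function : Prop :=
  [/\ forall v, linear (kappa^~ v), forall u, linear (kappa u)
    & forall i j, kappa (bvec i) (bvec j) = - (q i j *: kappa (bvec j) (bvec i))].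

Definition H_rel (t : TVG c) : Prop :=
  exists i j, t = skew_elt c [:: i] 0 * skew_elt c [:: j] 0
    - q i j *: (skew_elt c [:: j] 0 * skew_elt c [:: i] 0)
    - VG_in (kappa (bvec i) (bvec j)).

Definition H_alg := quotalg H_rel.
HB.instance Definition _ := GRing.PzRing.on H_alg.
HB.instance Definition _ := GRing.Lmodule.on H_alg.

Definition pbw_word (m : {ffun 'I_n -> nat}) : seq 'I_n :=
  flatten [seq nseq (m i) i | i <- enum 'I_n].

Definition pbw_elt (mg : {ffun 'I_n -> nat} * G) : H_alg :=
  quot_pi H_rel (skew_elt c (pbw_word mg.1) mg.2).

Definition quantum_Drinfeld_orbifold : Prop :=
  (forall x : H_alg, exists (s : seq ({ffun 'I_n -> nat} * G))
      (a : {ffun 'I_n -> nat} * G -> K), x = \sum_(mg <- s) a mg *: pbw_elt mg)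
  /\ (forall (s : seq ({ffun 'I_n -> nat} * G))
       (a : {ffun 'I_n -> nat} * G -> K), uniq s ->
       \sum_(mg <- s) a mg *: pbw_elt mg = 0 -> {in s, forall mg, a mg = 0}).

Definition strong_vanishing : Prop :=
  forall (g : G) (i j k r : 'I_n), kappa (bvec i) (bvec j) g 0 r != 0 ->
    gact c g (bvec k) = (q i k * q j k * q k r) *: bvec k.

Definition degA_v (i : 'I_n) : 'rV[int]_n * G := (delta_mx 0 i, 0).
Definition degA_g (g : G) : 'rV[int]_n * G := (0, g).

Definition N_gen (x : 'rV[int]_n * G) : Prop :=
  exists (i j r : 'I_n) (g : G), kappa (bvec i) (bvec j) g 0 r != 0 /\
    x = degA_v i + degA_v j - degA_v r - degA_g g.

Definition AN : zmodType := Quotient.quot (subgroup_gen N_gen).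

Definition deg_v (i : 'I_n) : AN := \pi_AN (degA_v i).
Definition deg_g (g : G) : AN := \pi_AN (degA_g g).

(* The degree-b components: the spans of the basis vectors of degree b. *)
Definition grV (b : AN) (v : 'rV[K]_n) : Prop :=
  forall i, v 0 i != 0 -> deg_v i = b.
Definition grKG (b : AN) (r : KG K G) : Prop :=
  forall g, r@_g != 0 -> deg_g g = b.
Definition grL (b : AN) (x : VG c) : Prop :=
  forall g i, x g 0 i != 0 -> deg_v i + deg_g g = b.

(* The bilinear extension of [v_i (x) g, v_j (x) h] = kappa(v_i, ^g v_j) gh. *)
Definition bracket (x y : VG c) : VG c :=
  \sum_(g : G) \sum_(h : G) ract (kappa (x g) (gact c g (y h))) (gelt K (g + h)).

Lemma bracketE i g j h : parameter_function ->
  bracket (tens c (bvec i) g) (tens c (bvec j) h) =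
  ract (kappa (bvec i) (gact c g (bvec j))) (gelt K (g + h)).
Proof.
case=> kl kr _; have k0 v : kappa 0 v = 0.
  by rewrite -[0 in LHS](subrr (0 : 'rV[K]_n)) -scaleN1r addrC kl scaleN1r addNr.
have k0r v : kappa v 0 = 0.
  by rewrite -[0 in LHS](subrr (0 : 'rV[K]_n)) -scaleN1r addrC kr scaleN1r addNr.
have r0 (r : KG K G) : ract (0 : VG c) r = 0.
  by rewrite -[0 in LHS](subrr (0 : VG c)) -scaleN1r addrC ract_linearl
    scaleN1r addNr.
rewrite /bracket (bigD1 g) //= (bigD1 h) //= !ffunE !eqxx !big1 ?addr0 //.
- by move=> g' /negPf ng; rewrite big1 // => h' _; rewrite !ffunE ng k0 r0.
- by move=> h' /negPf nh; rewrite !ffunE nh gact_0 k0r r0.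
Qed.

End DrinfeldOrbifold.

Arguments grV {K n G c} kappa b v.
Arguments grKG {K n G c} kappa b r.
Arguments grL {K n G c} kappa b x.

Definition Yetter_Drinfeld (K : fieldType) (n : nat) (G : finZmodType)
    (c : diag_action K n G) (B : zmodType) (eps : B -> B -> K)
    (grV : B -> 'rV[K]_n -> Prop) (degG : G -> B)
    (grR : B -> KG K G -> Prop) (grL : B -> VG c -> Prop)
    (br : VG c -> VG c -> VG c) : Prop :=
  [/\ color_Lie_ring eps grR grL br,
      is_grading grV,
      forall g, grR (degG g) (gelt K g),
      forall b v g, grV b v -> grL (b + degG g) (tens c v g)
    & forall g b v, grV b v -> gact c g v = eps (degG g) b *: v].

(* Main.v *)
Require Import Defs.
From HB Require Import structures.
From mathcomp Require Import all_boot all_order all_algebra.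
From mathcomp.multinomials Require Import monalg.
From mathcomp.classical Require Import boolp.

(* The bicharacter given on Z^n x G by q and the characters chi_i is trivial on
   N: against Z^n this is the strong vanishing condition, against G it is the
   G-equivariance of kappa. The latter, like the antisymmetry and the Jacobi
   identity of the bracket, is inherited from the associative algebra H: by the
   PBW property the map V (x) KG -> H is injective, and it turns the bracket
   into the epsilon-commutator x y - epsilon(|x|, |y|) y x. The isomorphism is
   obtained from the universal properties of U(L) and H. *)

Set Implicit Arguments.
Unset Strict Implicit.
Unset Printing Implicit Defensive.

Import GRing.Theory.
Local Open Scope ring_scope.
Local Open Scope quotient_scope.

(** The PBW property enters through the linear independence of the elements v_r g: an identity in L
    may be tested in H, where antisymmetry and Jacobi become formal identities of associative
    products, and no explicit system of conditions on kappa has to be written down. The value of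
    epsilon comes from the same computation. Moving g past v_j costs chi_j(g) and moving h past v_i
    costs chi_i(h), so the q_ij-commutator of v_i and v_j turns into a commutator of v_i g and v_j h
    twisted by q_ij chi_j(g) / chi_i(h). The passage to A/N is what makes kappa homogeneous, hence
    the bracket graded. The algebras U(L) and H are given by generators and relations and might a
    priori be zero. They are therefore handled as [quotalg], morphisms are plain functions with
    proofs of [linear] and [monoid_morphism], and each universal property has a [quotalg] as its
    target. *)

(** * Consequences of linearity for plain functions *)

Section LinearMaps.

Variables (K : fieldType) (U V : lmodType K) (f : U -> V).
Hypothesis lf : linear f.

Lemma linD_of : {morph f : x y / x + y}.
Proof. by move=> x y; have := lf 1 x y; rewrite !scale1r. Qed.

Lemma lin0_of : f 0 = 0.
Proof. by have := lf (-1) 0 0; rewrite !scaleN1r !addNr. Qed.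

Lemma linZ_of k x : f (k *: x) = k *: f x.
Proof. by have := lf k x 0; rewrite !addr0 lin0_of addr0. Qed.

Lemma linB_of : {morph f : x y / x - y}.
Proof. by move=> x y; rewrite linD_of -scaleN1r linZ_of scaleN1r. Qed.

Lemma lin_sum_of (I : Type) (s : seq I) (P : pred I) (F : I -> U) :
  f (\sum_(i <- s | P i) F i) = \sum_(i <- s | P i) f (F i).
Proof. exact: (big_morph f linD_of lin0_of). Qed.

End LinearMaps.

(** * Morphisms and twisted commutators in quotient algebras *)

Section QuotientMorphisms.

Variables (K : fieldType) (A A' : algType K) (X : A -> Prop) (Y : A' -> Prop).

Lemma quot_pi_linear : linear (quot_pi X).
Proof. by move=> k x y; rewrite quot_piD -quot_scaleE. Qed.

(** Universal property of a quotient. The target is a [quotalg] as well, since this is the structure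
    that U(L) and H share. *)
Lemma quot_lift (F : A -> quotalg Y) : linear F -> monoid_morphism F ->
  (forall x, X x -> F x = 0) ->
  exists F' : quotalg X -> quotalg Y,
    [/\ linear F', monoid_morphism F' & forall x, F' (quot_pi X x) = F x].
Proof.
move=> lF mF FX; pose F' (x : quotalg X) := F (repr x).
(* Vanishing on the generators spreads to the ideal; this makes F' independent of the
   representatives chosen by [repr]. *)
have FI x : in_ideal X x -> F x = 0.
  elim=> {x} [x /FX // | | x y _ Hx _ Hy | a x _ Hx | a x _ Hx].
  - exact: lin0_of lF.
  - by rewrite (linB_of lF) Hx Hy subr0.
  - by rewrite mF.2 Hx mulr0.
  - by rewrite mF.2 Hx mul0r.
have F'E x : F' (quot_pi X x) = F x.
  apply/eqP; rewrite -subr_eq0 -(linB_of lF); apply/eqP/FI/quot_piP.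
  exact: quot_piK.
exists F'; split=> //.
  move=> k x y; rewrite -[x]quot_piK -[y]quot_piK quot_scaleE -quot_piD.
  by rewrite !F'E lF.
split; first by rewrite [LHS]F'E mF.1.
by move=> x y; rewrite -[x]quot_piK -[y]quot_piK quot_mulE !F'E mF.2.
Qed.

End QuotientMorphisms.

Lemma quotZMl (K : fieldType) (A : algType K) (X : A -> Prop) k
  (x y : quotalg X) : (k *: x) * y = k *: (x * y).
Proof. by rewrite -quotalg_scalerAl. Qed.

Lemma quotZMr (K : fieldType) (A : algType K) (X : A -> Prop) k
  (x y : quotalg X) : x * (k *: y) = k *: (x * y).
Proof. by rewrite -quotalg_scalerAr. Qed.

(** The scalar [e] stands for epsilon(|u|, |w|). Leaving it free separates the identities of
    associative algebra from the grading. *)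
Definition qcomm (K : fieldType) (A : algType K) (X : A -> Prop) (e : K)
  (u w : quotalg X) : quotalg X := u * w - e *: (w * u).

Lemma qcomm_linearl (K : fieldType) (A : algType K) (X : A -> Prop) e w :
  linear ((@qcomm K A X e)^~ w).
Proof.
move=> k u v; rewrite /qcomm mulrDl mulrDr quotZMl quotZMr !scalerDr scalerN.
by rewrite !scalerA [e * k]mulrC opprD addrACA.
Qed.

Lemma qcomm_linearr (K : fieldType) (A : algType K) (X : A -> Prop) e u :
  linear (@qcomm K A X e u).
Proof.
move=> k v w; rewrite /qcomm mulrDl mulrDr quotZMl quotZMr !scalerDr scalerN.
by rewrite !scalerA [e * k]mulrC opprD addrACA.
Qed.

Lemma qcomm_anti (K : fieldType) (A : algType K) (X : A -> Prop) e
  (u w : quotalg X) : e != 0 -> qcomm e u w + e *: qcomm e^-1 w u = 0.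
Proof.
move=> nz; rewrite /qcomm scalerBr scalerA divff // scale1r addrA subrK.
exact: subrr.
Qed.

(** The relations [H_rel] and [env_rel] both have the shape u v - e v u - w, so this serves both
    directions of the isomorphism. *)
Lemma morphism_kills_commutator (K : fieldType) (A A' : algType K)
    (X : A -> Prop) (F : A' -> quotalg X) e u v w :
  linear F -> monoid_morphism F -> F w = qcomm e (F u) (F v) ->
  F (u * v - e *: (v * u) - w) = 0.
Proof.
move=> lF mF Fw; rewrite !(linB_of lF) (linZ_of lF) !mF.2 Fw.
exact: subrr.
Qed.

Lemma quot_commutator (K : fieldType) (A : algType K) (X : A -> Prop) k a b w :
  X (a * b - k *: (b * a) - w) ->
  quot_pi X a * quot_pi X b =
  k *: (quot_pi X b * quot_pi X a) + quot_pi X w.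
Proof.
move=> Xabw; rewrite !quot_mulE quot_scaleE -quot_piD.
by apply/quot_piP/in_ideal_gen; rewrite opprD addrA.
Qed.

Lemma quot_pi_monoid (K : fieldType) (A : algType K) (X : A -> Prop) :
  monoid_morphism (quot_pi X).
Proof. by split=> // x y; rewrite quot_mulE. Qed.

(** Since w = a b - m b a and r passes both a b and b a with the factor k l, it passes w with that
    factor. With r a group element and w the image of kappa(v_i, v_j), this is the equivariance of
    kappa. *)
Lemma quot_conj_commutator (K : fieldType) (A : algType K) (X : A -> Prop)
    (k l m : K) (r a b w : quotalg X) :
  r * a = k *: (a * r) -> r * b = l *: (b * r) -> a * b = m *: (b * a) + w ->
  r * w = (k * l) *: (w * r).
Proof.
have comm2 k1 k2 (x y : quotalg X) : r * x = k1 *: (x * r) ->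
    r * y = k2 *: (y * r) -> r * (x * y) = (k1 * k2) *: (x * y * r).
  by move=> rx ry; rewrite mulrA rx quotZMl -mulrA ry quotZMr scalerA mulrA.
move=> ra rb ab; have -> : w = - (m *: (b * a)) + a * b by rewrite ab addKr.
rewrite mulrDr mulrDl mulrN mulNr quotZMr quotZMl (comm2 k l a b) // (comm2 l k b a) //.
by rewrite scalerDr scalerN !scalerA [l * k]mulrC [m * _]mulrC.
Qed.

(** Reordering gives (a g)(b h) = k a b s and (b h)(a g) = l b a s, so m k / l is the scalar that
    turns the twisted commutator into k (a b - m b a) s. For a = v_i, b = v_j it is q_ij chi_j(g) /
    chi_i(h). *)
Lemma quot_tens_commutator (K : fieldType) (A : algType K) (X : A -> Prop)
    (k l m : K) (a b g h s w : quotalg X) : l != 0 ->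
  g * b = k *: (b * g) -> h * a = l *: (a * h) ->
  g * h = s -> h * g = s -> a * b = m *: (b * a) + w ->
  qcomm (m * k / l) (a * g) (b * h) = k *: (w * s).
Proof.
rewrite /qcomm.
move=> nzl gb ha gh hg ab.
have -> : a * g * (b * h) = k *: (a * b * s).
  by rewrite -mulrA [g * (b * h)]mulrA gb quotZMl -mulrA gh quotZMr mulrA.
have -> : b * h * (a * g) = l *: (b * a * s).
  by rewrite -mulrA [h * (a * g)]mulrA ha quotZMl -mulrA hg quotZMr mulrA.
rewrite ab mulrDl quotZMl scalerDr !scalerA divfK // [k * m]mulrC.
by rewrite addrC addKr.
Qed.

(** Here k, l, m are epsilon(|x|,|y|), epsilon(|y|,|z|), epsilon(|z|,|x|); by antisymmetry
    epsilon(|x|,|y||z|) is k / m, and so on cyclically. The outer weights clear these denominators,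
    and each of the six orderings of x, y, z then occurs twice with opposite coefficients. *)
Lemma quot_jacobi (K : fieldType) (A : algType K) (X : A -> Prop)
    (k l m : K) (x y z : quotalg X) : k != 0 -> l != 0 -> m != 0 ->
  m *: qcomm (k / m) x (qcomm l y z) + k *: qcomm (l / k) y (qcomm m z x)
  + l *: qcomm (m / l) z (qcomm k x y) = 0.
Proof.
move=> nzk nzl nzm; rewrite /qcomm !scalerBr !scalerA ![_ * (_ / _)]mulrC !divfK //.
rewrite !mulrBr !mulrBl !quotZMr !quotZMl !scalerBr !scalerA !mulrA.
rewrite [m * l]mulrC [k * m]mulrC [l * k]mulrC !opprB !addrA.
(* Each pair collects the two occurrences of one ordering, the positive one first. *)
rewrite (ACl ((1*12)*(7*2)*(3*10)*(5*4)*(11*6)*(9*8))) /=.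
by rewrite !subrr !addr0.
Qed.

(** Used for the symbol algebra behind T_R(L), for the skew group algebra and for KG, which are all
    twisted monoid algebras. *)
Lemma twalg_lift (K : fieldType) (M : twmonoid K) (A : algType K)
    (X : A -> Prop) (h : M -> quotalg X) :
  h (tw_one M) = 1 ->
  (forall a b, h a * h b = tw_coc a b *: h (tw_mul a b)) ->
  linear (lin_ext h : twalg M -> _) /\
  monoid_morphism (lin_ext h : twalg M -> _).
Proof.
move=> h1 hM; have lh : linear (lin_ext h : twalg M -> _).
  exact: lin_ext_linear.
split=> //; split; first by rewrite lin_extU.
move=> x y; move: x; apply: lin_extP => [k x x'|k x x'|a].
- by rewrite mulrDl -scalerAl lh.
- by rewrite lh mulrDl quotZMl.
move: y; apply: lin_extP => [k y y'|k y y'|b].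
- by rewrite mulrDr -scalerAr lh.
- by rewrite lh mulrDr quotZMr.
by rewrite twalgMU (linZ_of lh) !lin_extU hM.
Qed.

(** * Universal properties of T_R(L) and U(L) *)

Section TensorAlgebraLift.

Variables (K : fieldType) (R : algType K) (L : bimodType R).

Definition tensor_coef (r : R) : tensor_alg L :=
  quot_pi (@tensor_rel K R L) (tsymb [::] r).

Lemma tensor_rel_eq (x y : twalg (tsym_monoid L)) : tensor_rel (x - y) ->
  quot_pi (@tensor_rel K R L) x = quot_pi (@tensor_rel K R L) y.
Proof. by move=> Hxy; apply/quot_piP/in_ideal_gen. Qed.

Lemma tensor_in_linear : linear (@tensor_in K R L).
Proof.
move=> k l l'; rewrite /tensor_in -quot_pi_linear; apply: tensor_rel_eq.
by rewrite opprD addrA; apply: (tensor_rel_lin [::]).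
Qed.

Lemma tensor_coef_linear : linear tensor_coef.
Proof.
move=> k r s; rewrite /tensor_coef -quot_pi_linear; apply: tensor_rel_eq.
by rewrite opprD addrA; apply: tensor_rel_scal.
Qed.

Lemma tensor_coef_monoid : monoid_morphism tensor_coef.
Proof.
split=> // r s; rewrite /tensor_coef.
by rewrite [RHS]quot_mulE tsymbM.
Qed.

Lemma tensor_in_lact r l : tensor_in (lact r l) = tensor_coef r * tensor_in l.
Proof. by rewrite [RHS]quot_mulE tsymbM. Qed.

Lemma tensor_in_ract l r : tensor_in (ract l r) = tensor_in l * tensor_coef r.
Proof.
rewrite [RHS]quot_mulE tsymbM /= mul1r; apply: tensor_rel_eq.
by have := tensor_rel_last [::] l r 1; rewrite mulr1.
Qed.

(** Uniqueness half of the universal property: a symbol (l :: w, r) is the product of l and (w, r),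
    so L and R generate T_R(L). *)
Lemma tensor_algP (A : algType K) (X : A -> Prop)
    (f f' : tensor_alg L -> quotalg X) :
  linear f -> monoid_morphism f -> linear f' -> monoid_morphism f' ->
  (forall l, f (tensor_in l) = f' (tensor_in l)) ->
  (forall r, f (tensor_coef r) = f' (tensor_coef r)) -> f =1 f'.
Proof.
move=> lf mf lf' mf' fin fco x; rewrite -[x]quot_piK; move: (repr _) => y.
elim/pre_ind: y => [|k w r y IH].
  by rewrite !(lin0_of (@quot_pi_linear _ _ _)) (lin0_of lf) (lin0_of lf').
rewrite !quot_pi_linear lf lf' IH; congr (_ *: _ + _).
elim: w => [|l w IHw]; first exact: fco.
have -> : quot_pi (@tensor_rel K R L) (tsymb (l :: w) r) =
    tensor_in l * quot_pi (@tensor_rel K R L) (tsymb w r).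
  (* The coefficient 1 of the left factor is absorbed by the slot r if w is empty, and by the left
     action on the next letter otherwise. *)
  rewrite [RHS]quot_mulE tsymbM; case: w {IHw} => [|l' w] /=.
    by rewrite mul1r.
  by rewrite lact1.
by rewrite mf.2 mf'.2 fin IHw.
Qed.

Variables (A : algType K) (X : A -> Prop).
Variables (pl : L -> quotalg X) (rho : R -> quotalg X).
Hypotheses (pl_lin : linear pl) (rho_lin : linear rho).
Hypothesis rho_mon : monoid_morphism rho.
Hypothesis pl_lact : forall r l, pl (lact r l) = rho r * pl l.
Hypothesis pl_ract : forall l r, pl (ract l r) = pl l * rho r.

Lemma tensor_alg_lift : exists F : tensor_alg L -> quotalg X,
  [/\ linear F, monoid_morphism F, forall l, F (tensor_in l) = pl l
    & forall r, F (tensor_coef r) = rho r].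
Proof.
(* A symbol stands for l_1 ... l_m r, which dictates its image. *)
pose h (x : tsym_monoid L) : quotalg X := (\prod_(l <- x.1) pl l) * rho x.2.
have [lh mh] : linear (lin_ext h : twalg (tsym_monoid L) -> _) /\
    monoid_morphism (lin_ext h : twalg (tsym_monoid L) -> _).
  apply: twalg_lift => [|[w r] [w' r']].
    by rewrite /h /= big_nil mul1r rho_mon.1.
  rewrite /= scale1r /h /tsym_mul /=; case: w' => [|l w'] /=.
    by rewrite big_nil mul1r rho_mon.2 mulrA.
  by rewrite big_cat !big_cons /= pl_lact !mulrA.
have hE w r : lin_ext h (tsymb w r) = (\prod_(l <- w) pl l) * rho r.
  by rewrite lin_extU.
have [|F [lF mF FE]] := @quot_lift K _ A (@tensor_rel K R L) X _ lh mh.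
  move=> x; case=> [w k r s|w k l l' w2 r|w l s l' w2 r|w l s r].
  - rewrite !(linB_of lh) (linZ_of lh) !hE rho_lin mulrDr quotZMr.
    by rewrite -addrA -opprD subrr.
  - rewrite !(linB_of lh) (linZ_of lh) !hE !big_cat !big_cons /= pl_lin.
    rewrite mulrDl mulrDr mulrDl quotZMl quotZMr quotZMl.
    by rewrite -addrA -opprD subrr.
  - rewrite !(linB_of lh) !hE !big_cat !big_cons /= pl_ract pl_lact.
    by rewrite !mulrA subrr.
  - rewrite !(linB_of lh) !hE !big_rcons /= pl_ract rho_mon.2.
    by rewrite !mulrA subrr.
exists F; split=> // [l|r]; rewrite [LHS]FE hE.
  by rewrite big_seq1 rho_mon.1 mulr1.
by rewrite big_nil mul1r.
Qed.

Lemma universal_env_lift (B : zmodType) (eps : B -> B -> K)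
    (gr : B -> L -> Prop) (br : L -> L -> L) :
  (forall a b x y, gr a x -> gr b y ->
    pl (br x y) = qcomm (eps a b) (pl x) (pl y)) ->
  exists f : quotalg (env_rel eps gr br) -> quotalg X,
  [/\ linear f, monoid_morphism f,
      forall l, f (quot_pi (env_rel eps gr br) (tensor_in l)) = pl l
    & forall r, f (quot_pi (env_rel eps gr br) (tensor_coef r)) = rho r].
Proof.
move=> pl_br; have [F [lF mF Fin Fco]] := tensor_alg_lift.
have [|f [lf mf fE]] := @quot_lift K _ _ (env_rel eps gr br) _ F lF mF.
  move=> _ [a [b [u [v [Hu Hv ->]]]]].
  apply: morphism_kills_commutator => //.
  by rewrite !Fin; apply: pl_br.
by exists f; split=> // [l|r]; rewrite fE.
Qed.

End TensorAlgebraLift.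

(** * Universal property of the skew group algebra *)

Section SkewAlgebraLift.

Variables (K : fieldType) (n : nat) (G : finZmodType).
Variable c : diag_action K n G.
Variables (A : algType K) (X : A -> Prop).

Lemma skew_algP (f f' : TVG c -> quotalg X) :
  linear f -> monoid_morphism f -> linear f' -> monoid_morphism f' ->
  (forall i, f (skew_elt c [:: i] 0) = f' (skew_elt c [:: i] 0)) ->
  (forall g, f (skew_elt c [::] g) = f' (skew_elt c [::] g)) -> f =1 f'.
Proof.
move=> lf mf lf' mf' fin fco; apply: lin_extP => // -[w g].
rewrite -/(skew_elt c w g); elim: w => [|i w IH]; first exact: fco.
have -> : skew_elt c (i :: w) g = skew_elt c [:: i] 0 * skew_elt c w g.
  rewrite [RHS]twalgMU /= /skew_coc big1 => [|j _]; last exact: chi0.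
  by rewrite scale1r /skew_mul /= add0r.
by rewrite mf.2 mf'.2 fin IH.
Qed.

Variables (p : 'I_n -> quotalg X) (rho : G -> quotalg X).
Hypotheses (rho0 : rho 0 = 1) (rhoD : forall g h, rho (g + h) = rho g * rho h).
Hypothesis rho_p : forall g i, rho g * p i = c i g *: (p i * rho g).

Lemma skew_alg_lift : exists F : TVG c -> quotalg X,
  [/\ linear F, monoid_morphism F, forall i, F (skew_elt c [:: i] 0) = p i
    & forall g, F (skew_elt c [::] g) = rho g].
Proof.
pose h (x : skew_monoid c) : quotalg X := (\prod_(i <- x.1) p i) * rho x.2.
(* Moving g past a word collects the chi_i(g) of its letters, which is the cocycle [skew_coc]. *)
have rho_w g w : rho g * \prod_(i <- w) p i =
    (\prod_(i <- w) c i g) *: ((\prod_(i <- w) p i) * rho g).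
  elim: w => [|i w IH]; first by rewrite !big_nil scale1r mul1r mulr1.
  rewrite !big_cons mulrA rho_p quotZMl -mulrA IH quotZMr scalerA.
  by rewrite mulrA.
have [lh mh] : linear (lin_ext h : TVG c -> _) /\
    monoid_morphism (lin_ext h : TVG c -> _).
  apply: twalg_lift => [|[w g] [w' g']].
    by rewrite /h /= big_nil mul1r.
  rewrite /= /h /skew_mul /skew_coc /= -mulrA [rho g * _]mulrA rho_w.
  by rewrite quotZMl quotZMr big_cat rhoD !mulrA.
exists (lin_ext h); split=> // [i|g]; rewrite lin_extU /h /=.
  by rewrite big_seq1 rho0 mulr1.
by rewrite big_nil mul1r.
Qed.

End SkewAlgebraLift.

(** * Gradings given by a homogeneous basis, one argument for V, KG and L *)

Section CoordinateGradings.

Variables (K : fieldType) (B : zmodType) (M : lmodType K) (I : finType).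
Variables (e : I -> M) (co : I -> M -> K) (deg : I -> B).
Hypothesis co_lin : forall i k x y, co i (k *: x + y) = k * co i x + co i y.
Hypothesis co_e : forall i j, co i (e j) = (i == j)%:R.
Hypothesis coK : forall x, x = \sum_i co i x *: e i.

Variable gr : B -> M -> Prop.
Hypothesis grE : forall b x, gr b x <-> forall i, co i x != 0 -> deg i = b.

Let co_linear i : linear (co i : M -> K^o).
Proof. exact: co_lin. Qed.

Lemma gr_basis i : gr (deg i) (e i).
Proof.
apply/grE => j; rewrite co_e; case: (j =P i) => [-> //|_].
by rewrite eqxx.
Qed.

Lemma gr0 b : gr b 0.
Proof. by apply/grE => i; rewrite (lin0_of (co_linear i)) eqxx. Qed.

Lemma gr_linear b k x y : gr b x -> gr b y -> gr b (k *: x + y).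
Proof.
move=> /grE Hx /grE Hy; apply/grE => i; rewrite co_lin.
have [->|/Hx //] := eqVneq (co i x) 0.
by rewrite mulr0 add0r => /Hy.
Qed.

Lemma gr_ind (P : M -> Prop) b : P 0 ->
  (forall k x y, P x -> P y -> P (k *: x + y)) ->
  (forall i, deg i = b -> P (e i)) -> forall x, gr b x -> P x.
Proof.
move=> P0 PD Pe x /grE Hx; rewrite [x]coK.
apply: (big_ind P) => // [y z Py Pz|i _].
  by rewrite -[y]scale1r; apply: PD.
have [->|/Hx/Pe Pi] := eqVneq (co i x) 0; first by rewrite scale0r.
by rewrite -[_ *: _]addr0; apply: PD.
Qed.

Lemma coord_grading : is_grading gr.
Proof.
split=> [b|b k x y|x|s f us Hf f0 b bs].
- exact: gr0.
- exact: gr_linear.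
(* Several basis vectors may share a degree; [undup] lists each degree once, so that no basis vector
   is counted twice. *)
- exists (undup [seq deg i | i <- enum I]).
  exists (fun b => \sum_(i | deg i == b) co i x *: e i); split=> [b|].
    apply: (big_ind (gr b)) => [|y z Hy Hz|i /eqP <-]; first exact: gr0.
      by rewrite -[y]scale1r; apply: gr_linear.
    by rewrite -[_ *: _]addr0; apply: gr_linear (gr_basis i) (gr0 _).
  rewrite {1}[x]coK (exchange_big_dep xpredT) //=; apply: eq_bigr => i _.
  rewrite -big_filter (_ : [seq _ <- _ | _] = [:: deg i]) ?big_seq1 //.
  rewrite (@eq_filter _ _ (pred1 (deg i))) => [|b]; last exact: eq_sym.
  rewrite filter_pred1_uniq ?undup_uniq //.
  by rewrite mem_undup map_f ?mem_enum.
rewrite [f b]coK big1 // => i _.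
have [e0|/(proj1 (grE _ _) (Hf b)) db] := eqVneq (co i (f b)) 0.
  by rewrite e0 scale0r.
suff -> : co i (f b) = 0 by rewrite scale0r.
(* As deg i = b, only the summand f b can have a nonzero i-th coordinate. *)
have := congr1 (co i) f0; rewrite (lin0_of (co_linear i)).
rewrite (lin_sum_of (co_linear i)) (bigD1_seq b) //= big1 ?addr0 //.
move=> b' nb; apply/eqP/negPn/negP => /(proj1 (grE _ _) (Hf b')) db'.
by rewrite -db' db eqxx in nb.
Qed.

End CoordinateGradings.

(** * Descent of an antisymmetric bicharacter to a quotient group *)

Section QuotientBicharacter.

Variables (K : fieldType) (A : zmodType) (S : A -> Prop).

Local Notation Q := (Quotient.quot (subgroup_gen S)).

Lemma subgroup_piD (x y : A) : \pi_Q (x + y) = \pi_Q x + \pi_Q y.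
Proof. by rewrite !piE. Qed.

Lemma subgroup_pi_eq (x y : A) :
  \pi_Q x = \pi_Q y <-> in_subgroup S (x - y).
Proof.
split=> [/eqP|H].
  by rewrite -Quotient.idealrBE => /asboolP.
by apply/eqP; rewrite -Quotient.idealrBE; apply/asboolP.
Qed.

Variable e0 : A -> A -> K.
Hypothesis e0_bichar : bicharacter e0.
Hypothesis e0_anti : antisymmetric_bichar e0.

Lemma bichar0r x : e0 x 0 = 1.
Proof.
case: e0_bichar => nz Dr _; apply: (mulfI (nz x 0)).
by rewrite -Dr addr0 mulr1.
Qed.

Lemma bicharNr x y : e0 x (- y) = (e0 x y)^-1.
Proof.
case: e0_bichar => nz Dr _; apply: (mulfI (nz x y)).
by rewrite -Dr subrr bichar0r mulfV.
Qed.

(** Testing the generators in the second argument suffices, because antisymmetry carries triviality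
    over to the first. *)
Lemma quot_bicharacter : (forall x y, S y -> e0 x y = 1) ->
  exists eps : Q -> Q -> K,
    [/\ bicharacter eps, antisymmetric_bichar eps
      & forall x y, eps (\pi_Q x) (\pi_Q y) = e0 x y].
Proof.
move=> eS; case: (e0_bichar) => nz Dr Dl.
have eN x y : in_subgroup S y -> e0 x y = 1.
  elim=> {y} [y /eS //| |y z _ Hy _ Hz]; first exact: bichar0r.
  by rewrite Dr bicharNr Hy Hz divr1.
have epi x y z : \pi_Q y = \pi_Q z -> e0 x y = e0 x z.
  move=> /subgroup_pi_eq/(eN x); rewrite Dr bicharNr => /divr1_eq //.
exists (fun a b => e0 (repr a) (repr b)).
have piK (a : Q) : \pi_Q (repr a) = a by rewrite reprK.
(* Change the second representative, swap the arguments by antisymmetry, then change the other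
   one. *)
have eE x y : e0 (repr (\pi_Q x)) (repr (\pi_Q y)) = e0 x y.
  rewrite (epi _ _ y (piK _)) e0_anti [in RHS]e0_anti.
  by rewrite (epi _ _ x (piK _)).
split=> //; split=> [a b|a b c|a b c]; first exact: nz.
  by rewrite -[a]piK -[b]piK -[c]piK -subgroup_piD !eE Dr.
by rewrite -[a]piK -[b]piK -[c]piK -subgroup_piD !eE Dl.
Qed.

End QuotientBicharacter.

(** * The bicharacter on Z^n x G *)

Section GroupBicharacter.

Variables (K : fieldType) (n : nat) (G : finZmodType).
Variables (c : diag_action K n G) (q : 'I_n -> 'I_n -> K).
Hypothesis Hq : quantum_params q.

Local Notation A := ('rV[int]_n * G)%type.

Lemma chi_neq0 i g : c i g != 0.
Proof.
apply/eqP => z; have := chiD c i g (- g).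
by rewrite subrr chi0 z mul0r => /eqP; rewrite oner_eq0.
Qed.

(** The weight of the Laurent monomial v^a under g. *)
Definition chi_pow (a : 'rV[int]_n) (g : G) : K := \prod_i c i g ^ a 0 i.
Definition q_pow (a : 'rV[int]_n) (j : 'I_n) : K := \prod_i q i j ^ a 0 i.

Definition q_form (a b : 'rV[int]_n) : K := \prod_j q_pow a j ^ b 0 j.

(* epsilon((a, g), (b, h)) = q^(a, b) chi^b(g) chi^(-a)(h) before passing to
   the quotient by N. *)
Definition group_bichar (x y : A) : K :=
  q_form x.1 y.1 * chi_pow y.1 x.2 / chi_pow x.1 y.2.

Lemma chi_pow_neq0 a g : chi_pow a g != 0.
Proof. by apply/prodf_neq0 => i _; rewrite expfz_neq0 ?chi_neq0. Qed.

Lemma q_pow_neq0 a j : q_pow a j != 0.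
Proof. by case: Hq => nz _ _; apply/prodf_neq0 => i _; rewrite expfz_neq0. Qed.

Lemma chi_powDl a b g : chi_pow (a + b) g = chi_pow a g * chi_pow b g.
Proof.
rewrite -big_split; apply: eq_bigr => i _ /=.
by rewrite mxE expfzDr ?chi_neq0.
Qed.

Lemma chi_powDr a g h : chi_pow a (g + h) = chi_pow a g * chi_pow a h.
Proof.
by rewrite -big_split; apply: eq_bigr => i _ /=; rewrite chiD expfzMl.
Qed.

Lemma q_powD a b j : q_pow (a + b) j = q_pow a j * q_pow b j.
Proof.
case: Hq => nz _ _; rewrite -big_split; apply: eq_bigr => i _ /=.
by rewrite mxE expfzDr.
Qed.

Lemma q_formDl a b d : q_form (a + b) d = q_form a d * q_form b d.
Proof.
rewrite -big_split; apply: eq_bigr => i _ /=.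
by rewrite q_powD expfzMl.
Qed.

Lemma q_formDr a b d : q_form a (b + d) = q_form a b * q_form a d.
Proof.
rewrite -big_split; apply: eq_bigr => i _ /=.
by rewrite mxE expfzDr ?q_pow_neq0.
Qed.

Lemma group_bicharP : bicharacter group_bichar.
Proof.
split=> [x y|x y z|x y z]; rewrite /group_bichar /=.
- rewrite !mulf_neq0 ?invr_eq0 ?chi_pow_neq0 //.
  by apply/prodf_neq0 => i _; rewrite expfz_neq0 ?q_pow_neq0.
- by rewrite q_formDr chi_powDl chi_powDr invfM
    (mulrACA (q_form _ _)) [LHS]mulrACA.
- by rewrite q_formDl chi_powDl chi_powDr invfM (mulrACA (q_form _ _)) [LHS]mulrACA.
Qed.

Lemma group_bichar_anti : antisymmetric_bichar group_bichar.
Proof.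
case: Hq => _ _ qV x y; rewrite /group_bichar !invfM invrK mulrAC.
congr (_ * _ * _); rewrite /q_form -prodfV.
(* The two chi-factors have merely changed places. The q-part is written as a double product of
   q_ij^(a_i b_j), so that exchanging i and j and using q_ji = 1 / q_ij inverts it. *)
have qX (a b : 'rV[int]_n) j :
    q_pow a j ^ b 0 j = \prod_i q i j ^ (a 0 i * b 0 j).
  rewrite /q_pow (big_morph (fun x => x ^ b 0 j) (id1 := 1) (op1 := *%R)).
  - by apply: eq_bigr => i _; rewrite exprz_exp.
  - by move=> u v; rewrite expfzMl.
  - exact: exp1rz.
under eq_bigr do rewrite qX.
under [RHS]eq_bigr do rewrite qX -prodfV.
rewrite exchange_big; apply: eq_bigr => j _; apply: eq_bigr => i _ /=.
by rewrite [X in X ^ _]qV mulrC exprz_inv invr_expz.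
Qed.

Lemma prod_delta (F : 'I_n -> K) i : \prod_j F j ^ (delta_mx 0 i : 'rV[int]_n) 0 j = F i.
Proof.
rewrite (bigD1 i) //= big1 ?mulr1 => [|j /negPf nj].
  by rewrite mxE !eqxx expr1z.
by rewrite mxE nj andbF expr0z.
Qed.

Lemma group_bichar_v x j :
  group_bichar x (degA_v G j) = q_pow x.1 j * c j x.2.
Proof.
rewrite /group_bichar /q_form /chi_pow /= !prod_delta big1 ?divr1 //.
by move=> i _; rewrite chi0 exp1rz.
Qed.

Lemma group_bichar_g x g :
  group_bichar x (degA_g n g) = (chi_pow x.1 g)^-1.
Proof.
have e a : q_form a 0 = 1 by apply: big1 => i _; rewrite mxE expr0z.
have f h : chi_pow 0 h = 1 by apply: big1 => i _; rewrite mxE expr0z.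
by rewrite /group_bichar /= e f !mul1r.
Qed.

Lemma group_bichar_basis i g j h :
  group_bichar (degA_v G i + degA_g n g) (degA_v G j + degA_g n h) =
    q i j * c j g / c i h.
Proof.
case: group_bicharP => _ Dr _; rewrite Dr group_bichar_v group_bichar_g.
by rewrite /q_pow /chi_pow /= addr0 add0r !prod_delta.
Qed.

End GroupBicharacter.

(** * The bimodule V (x) KG and its embedding in the skew group algebra *)

Section DiagonalBimodule.

Variables (K : fieldType) (n : nat) (G : finZmodType).
Variable c : diag_action K n G.

Local Notation V := 'rV[K]_n.
Local Notation L := (VG c).

Lemma bvec_sum (v : V) : v = \sum_i v 0 i *: bvec i.
Proof. exact: row_sum_delta. Qed.

Lemma gact_bvec g i : gact c g (bvec i) = c i g *: bvec i.
Proof.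
by apply/rowP => j; rewrite !mxE eqxx; case: (j =P i) => [->|_]; rewrite ?mulr0.
Qed.

Lemma tens_linear g : linear ((tens c)^~ g).
Proof.
move=> k u v; apply/ffunP => h; rewrite !ffunE.
by case: eqP => // _; rewrite scaler0 addr0.
Qed.

Lemma tensZ k v g : tens c (k *: v) g = k *: tens c v g.
Proof. exact: (linZ_of (tens_linear g)). Qed.

Lemma VG_sum (x : L) : x = \sum_g \sum_i x g 0 i *: tens c (bvec i) g.
Proof.
apply/ffunP => h; rewrite sum_ffunE (bigD1 h) //= sum_ffunE.
rewrite [X in _ + X]big1 ?addr0 => [|g ng].
  by rewrite {1}[x h]bvec_sum; apply: eq_bigr => i _; rewrite !ffunE eqxx.
rewrite sum_ffunE big1 // => i _.
by rewrite !ffunE eq_sym (negPf ng) scaler0.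
Qed.

Lemma VG_linP (U : lmodType K) (f f' : L -> U) : linear f -> linear f' ->
  (forall g i, f (tens c (bvec i) g) = f' (tens c (bvec i) g)) -> f =1 f'.
Proof.
move=> lf lf' ff' x; rewrite [x]VG_sum !lin_sum_of //.
apply: eq_bigr => g _; rewrite !lin_sum_of //.
by apply: eq_bigr => i _; rewrite !linZ_of // ff'.
Qed.

Lemma VG_in_linear : linear (@VG_in K n G c).
Proof.
move=> k x y; rewrite /VG_in scaler_sumr -big_split /=.
apply: eq_bigr => g _; rewrite scaler_sumr -big_split /=.
by apply: eq_bigr => i _; rewrite !ffunE !mxE scalerDl scalerA.
Qed.

Lemma VG_in_tens i g : VG_in (tens c (bvec i) g) = skew_elt c [:: i] g.
Proof.
rewrite /VG_in (bigD1 g) //= [X in _ + X]big1 ?addr0 => [|h nh].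
  rewrite (bigD1 i) //= big1 ?addr0 => [|j nj].
    by rewrite ffunE eqxx mxE !eqxx scale1r.
  by rewrite ffunE eqxx mxE (negPf nj) andbF scale0r.
by apply: big1 => j _; rewrite ffunE (negPf nh) mxE scale0r.
Qed.

Lemma lact_tens a v g : lact (gelt K a) (tens c v g) = tens c (gact c a v) (a + g).
Proof.
by rewrite -[RHS]/(tens _ _ _) -[a + g]addr0 -lact_ract_tens [RHS]ract1.
Qed.

Lemma ract_tens v g b : ract (tens c v g) (gelt K b) = tens c v (g + b).
Proof.
by rewrite -{1}[tens c v g]lact1 [LHS]lact_ract_tens gact0 add0r.
Qed.

Lemma skew_eltM w g w' g' : skew_elt c w g * skew_elt c w' g' =
  (\prod_(i <- w') c i g) *: skew_elt c (w ++ w') (g + g').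
Proof. exact: twalgMU. Qed.

Lemma VG_in_lact a x :
  VG_in (lact (gelt K a) x) = skew_elt c [::] a * VG_in x.
Proof.
move: x; apply: VG_linP => [k x y|k x y|g i].
- by rewrite lact_linearr VG_in_linear.
- by rewrite VG_in_linear mulrDr scalerAr.
rewrite lact_tens gact_bvec tensZ (linZ_of VG_in_linear).
by rewrite !VG_in_tens skew_eltM big_seq1.
Qed.

Lemma VG_in_ract x b :
  VG_in (ract x (gelt K b)) = VG_in x * skew_elt c [::] b.
Proof.
move: x; apply: VG_linP => [k x y|k x y|g i].
- by rewrite ract_linearl VG_in_linear.
- by rewrite VG_in_linear mulrDl scalerAl.
by rewrite ract_tens !VG_in_tens skew_eltM big_nil scale1r.
Qed.

End DiagonalBimodule.

(** * The map from V (x) KG to H, and equivariance of kappa *)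

Section PBW.

Variables (K : fieldType) (n : nat) (G : finZmodType).
Variables (c : diag_action K n G) (q : 'I_n -> 'I_n -> K).
Variable kappa : 'rV[K]_n -> 'rV[K]_n -> VG c.
Hypothesis HPBW : quantum_Drinfeld_orbifold q kappa.

Local Notation H := (quotalg (H_rel q kappa)).
Local Notation piH := (quot_pi (H_rel q kappa)).

Definition piL (x : VG c) : H := piH (VG_in x).

Lemma piL_linear : linear piL.
Proof. by move=> k x y; rewrite /piL VG_in_linear quot_pi_linear. Qed.

Lemma pbw_word1 r : pbw_word [ffun i : 'I_n => (i == r : nat)] = [:: r].
Proof.
rewrite /pbw_word -(filter_pred1_uniq (enum_uniq 'I_n) (mem_enum _ r)).
elim: (enum 'I_n) => //= i s ->; rewrite ffunE.
by case: (i == r).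
Qed.

(* The elements v_r g are part of the PBW basis. *)
Lemma piL_inj x : piL x = 0 -> x = 0.
Proof.
pose m (gr : G * 'I_n) := ([ffun i : 'I_n => (i == gr.2 : nat)], gr.1).
have m_inj : injective m.
  move=> [g r] [h s] [/ffunP/(_ r)]; rewrite !ffunE eqxx /=.
  by case: eqP => // -> _ ->.
(* The coefficients must be defined for all exponent vectors; this formula reads them off without
   inverting m and takes the value [x g 0 r] at m (g, r). *)
pose a (mg : {ffun 'I_n -> nat} * G) := \sum_r x mg.2 0 r *+ mg.1 r.
have am g r : a (m (g, r)) = x g 0 r.
  rewrite /a (bigD1 r) //= ffunE eqxx big1 ?addr0 // => s ns.
  by rewrite ffunE (negPf ns).
move=> x0; case: HPBW => _ /(_ [seq m gr | gr <- enum {: G * 'I_n}] a) free.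
have {free} := free _ _; rewrite map_inj_uniq ?enum_uniq // => /(_ isT).
move=> free; apply/ffunP => g; apply/rowP => r; rewrite !ffunE mxE -am.
apply: free; last by rewrite map_f // mem_enum.
rewrite big_map big_enum /= -[RHS]x0 /piL /VG_in pair_big /=.
rewrite (lin_sum_of (@quot_pi_linear _ _ _)); apply: eq_bigr => -[h s] _ /=.
by rewrite am /pbw_elt pbw_word1 quot_scaleE.
Qed.

Lemma H_relE i j :
  piL (tens c (bvec i) 0) * piL (tens c (bvec j) 0) =
  q i j *: (piL (tens c (bvec j) 0) * piL (tens c (bvec i) 0))
    + piL (kappa (bvec i) (bvec j)).
Proof.
by apply: quot_commutator; exists i, j; rewrite !VG_in_tens.
Qed.

Definition rhoH (r : KG K G) : H :=
  lin_ext (fun g => piH (skew_elt c [::] g)) r.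

Lemma rhoH_linear : linear rhoH.
Proof. exact: lin_ext_linear. Qed.

Lemma rhoH_gelt g : rhoH (gelt K g) = piH (skew_elt c [::] g).
Proof. exact: lin_extU. Qed.

Lemma rhoH_monoid : monoid_morphism rhoH.
Proof.
have [] // := @twalg_lift K (group_monoid K G) (TVG c) (H_rel q kappa)
  (fun g => piH (skew_elt c [::] g)) erefl.
by move=> a b; rewrite quot_mulE skew_eltM big_nil quot_scaleE.
Qed.

Lemma piL_lact r x : piL (lact r x) = rhoH r * piL x.
Proof.
move: r; apply: lin_extP => [k r s|k r s|g].
- by rewrite lact_linearl piL_linear.
- by rewrite rhoH_linear mulrDl quotZMl.
by rewrite rhoH_gelt quot_mulE -VG_in_lact.
Qed.

Lemma piL_ract x r : piL (ract x r) = piL x * rhoH r.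
Proof.
move: r; apply: lin_extP => [k r s|k r s|g].
- by rewrite ract_linearr piL_linear.
- by rewrite rhoH_linear mulrDr quotZMr.
by rewrite rhoH_gelt quot_mulE -VG_in_ract.
Qed.

Lemma piL_tens i g :
  piL (tens c (bvec i) g) = piL (tens c (bvec i) 0) * rhoH (gelt K g).
Proof. by rewrite -piL_ract ract_tens add0r. Qed.

Lemma rhoH_commute i g : rhoH (gelt K g) * piL (tens c (bvec i) 0) =
  c i g *: (piL (tens c (bvec i) 0) * rhoH (gelt K g)).
Proof.
rewrite -piL_lact -piL_ract; set x := ract _ _.
rewrite -[RHS](linZ_of piL_linear); congr piL.
by rewrite /x lact_tens ract_tens gact_bvec tensZ addrC.
Qed.

(* Conjugating the defining relation of v_i and v_j by g. *)
Lemma kappa_equivariant g i j :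
  lact (gelt K g) (kappa (bvec i) (bvec j)) =
  (c i g * c j g) *: ract (kappa (bvec i) (bvec j)) (gelt K g).
Proof.
apply/eqP; rewrite -subr_eq0; apply/eqP/piL_inj.
rewrite (linB_of piL_linear) (linZ_of piL_linear) piL_lact piL_ract.
apply/eqP; rewrite subr_eq0; apply/eqP.
exact: quot_conj_commutator (rhoH_commute i g) (rhoH_commute j g) (H_relE i j).
Qed.

(** Compare the coefficients of v_r (x) (h + g) in the equivariance identity; as G is abelian, left
    and right translation by g move h to the same place. *)
Lemma kappa_chi i j g r h : kappa (bvec i) (bvec j) h 0 r != 0 ->
  c r g = c i g * c j g.
Proof.
move=> nz; apply: (mulIf nz).
have := congr1 (fun x : VG c => x (h + g) 0 r) (kappa_equivariant g i j).
rewrite [lact _ _]VG_lact_gelt [ract _ _]VG_ract_gelt !ffunE !mxE.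
by rewrite addrK.
Qed.

End PBW.

(** * Universal property of H *)

Section OrbifoldLift.

Variables (K : fieldType) (n : nat) (G : finZmodType).
Variables (c : diag_action K n G) (q : 'I_n -> 'I_n -> K).
Variable kappa : 'rV[K]_n -> 'rV[K]_n -> VG c.
Variables (A : algType K) (X : A -> Prop).
Variables (pl : VG c -> quotalg X) (rho : KG K G -> quotalg X).
Hypotheses (pl_lin : linear pl) (rho_lin : linear rho).
Hypothesis rho_mon : monoid_morphism rho.
Hypothesis pl_lact : forall r x, pl (lact r x) = rho r * pl x.
Hypothesis pl_ract : forall x r, pl (ract x r) = pl x * rho r.
Hypothesis pl_kappa : forall i j, pl (kappa (bvec i) (bvec j)) =
  qcomm (q i j) (pl (tens c (bvec i) 0)) (pl (tens c (bvec j) 0)).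

(** Stated for a pair of maps on L and KG, the same data from which maps out of T_R(L) are built, so
    that the two lifts can be inverse to each other. *)
Lemma orbifold_lift : exists f : quotalg (H_rel q kappa) -> quotalg X,
  [/\ linear f, monoid_morphism f, forall x, f (piL q kappa x) = pl x
    & forall r, f (rhoH q kappa r) = rho r].
Proof.
have [||F [lF mF Fp Fr]] := @skew_alg_lift K n G c _ X
  (fun i => pl (tens c (bvec i) 0)) (fun g => rho (gelt K g)) rho_mon.1.
- by move=> g h; rewrite -rho_mon.2 geltM.
- move=> g i; rewrite -pl_lact -pl_ract lact_tens ract_tens gact_bvec tensZ.
  by rewrite (linZ_of pl_lin) addrC.
(* F is prescribed on the v_i and on G only; the value at v_i (x) g follows by writing it as the
   product of v_i and g. *)
have FL x : F (VG_in x) = pl x.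
  move: x; apply: VG_linP => [k x y|//|g i].
    by rewrite VG_in_linear lF.
  rewrite VG_in_tens -[g in LHS]add0r.
  have := skew_eltM c [:: i] 0 [::] g; rewrite big_nil scale1r cats0 => <-.
  by rewrite mF.2 Fp Fr -pl_ract ract_tens add0r.
have [|f [lf mf fE]] := @quot_lift K _ _ (H_rel q kappa) _ F lF mF.
  move=> _ [i [j ->]]; apply: morphism_kills_commutator => //.
  by rewrite [LHS]FL pl_kappa -!Fp.
exists f; split=> // [x|r]; first by rewrite [LHS]fE FL.
move: r; apply: lin_extP => [k r s|//|g]; first by rewrite rhoH_linear lf.
by rewrite -/(gelt K g) rhoH_gelt fE Fr.
Qed.

End OrbifoldLift.

(** * Gradings by A/N and the bracket *)

Section Bracket.

Variables (K : fieldType) (n : nat) (G : finZmodType).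
Variables (c : diag_action K n G) (q : 'I_n -> 'I_n -> K).
Variable kappa : 'rV[K]_n -> 'rV[K]_n -> VG c.
Hypothesis Hkappa : parameter_function q kappa.

Local Notation L := (VG c).
Local Notation B := (AN kappa).
Local Notation dv := (deg_v kappa).
Local Notation dg := (deg_g kappa).
Local Notation br := (bracket kappa).

Lemma deg_gD g h : dg (g + h) = dg g + dg h.
Proof.
rewrite -subgroup_piD; congr (\pi_B _).
by apply/pair_eqP/andP; split=> //=; rewrite addr0.
Qed.

Lemma deg_g0 : dg 0 = 0.
Proof. by apply: (addIr (dg 0)); rewrite -deg_gD !add0r. Qed.

(** This is the purpose of N: in A/N, kappa(v_i, v_j) is homogeneous of degree |v_i||v_j|. *)
Lemma deg_kappa i j g r : kappa (bvec i) (bvec j) g 0 r != 0 ->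
  dv i + dv j = dv r + dg g.
Proof.
move=> nz; rewrite -!subgroup_piD; apply/subgroup_pi_eq/in_subgroup_gen.
by exists i, j, r, g; rewrite opprD addrA.
Qed.

Lemma grV_grading : is_grading (grV kappa).
Proof.
apply: (@coord_grading _ _ _ _ (@bvec K n) (fun i v => v 0 i) dv) => //.
- by move=> i k x y; rewrite !mxE.
- by move=> i j; rewrite mxE.
- exact: bvec_sum.
Qed.

Lemma grKG_grE b (r : KG K G) :
  grKG kappa b r <-> forall g, r@_g != 0 -> dg g = b.
Proof. by []. Qed.

Lemma KG_sum (r : KG K G) : r = \sum_g r@_g *: gelt K g.
Proof.
apply/malgP => h; rewrite raddf_sum /= (bigD1 h) //= big1 ?addr0 => [|g nh].
  by rewrite mcoeffZ mcoeffUU mulr1.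
by rewrite mcoeffZ mcoeffU (negPf nh) mulr0.
Qed.

Lemma KG_co_lin (g : G) k (x y : KG K G) :
  (k *: x + y)@_g = k * x@_g + y@_g.
Proof. by rewrite mcoeffD mcoeffZ. Qed.

Lemma KG_co_e (g h : G) : (gelt K h)@_g = (g == h)%:R.
Proof. by rewrite mcoeffU eq_sym. Qed.

Lemma grKG_grading : is_grading (grKG kappa).
Proof.
exact: (@coord_grading _ _ _ _ (@gelt K G) (fun g r => r@_g) dg
  KG_co_lin KG_co_e KG_sum).
Qed.

Lemma grKG_gelt g : grKG kappa (dg g) (gelt K g).
Proof.
exact: (@gr_basis _ _ _ _ (@gelt K G) (fun g r => r@_g) dg KG_co_e _ grKG_grE).
Qed.

Lemma grKG_ind (P : KG K G -> Prop) b : P 0 ->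
  (forall k x y, P x -> P y -> P (k *: x + y)) ->
  (forall g, dg g = b -> P (gelt K g)) -> forall r, grKG kappa b r -> P r.
Proof.
exact: (@gr_ind _ _ _ _ (@gelt K G) (fun g r => r@_g) dg KG_sum _ grKG_grE).
Qed.

Lemma KG_mull (s : KG K G) : linear (fun r : KG K G => r * s).
Proof. exact: twalg_mull. Qed.

Lemma KG_mulr (r : KG K G) : linear ( *%R r).
Proof. exact: twalg_mulr. Qed.

Lemma grKG_algebra : graded_algebra (grKG kappa).
Proof.
have [gr0 grD _ _] := grKG_grading.
split; [exact: grKG_grading | by rewrite -deg_g0; apply: grKG_gelt |].
move=> a b r s Hr Hs; move: r Hr; apply: grKG_ind => [|k x y Hx Hy|g <-].
- by rewrite mul0r.
- by rewrite KG_mull; exact: grD Hx Hy.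
move: s Hs; apply: grKG_ind => [|k x y Hx Hy|h <-].
- by rewrite mulr0.
- by rewrite KG_mulr; exact: grD Hx Hy.
by rewrite geltM -deg_gD; apply: grKG_gelt.
Qed.

Definition VG_deg (gi : G * 'I_n) : B := dv gi.2 + dg gi.1.

Lemma grL_grE b (x : L) : grL kappa b x <->
  forall gi : G * 'I_n, x gi.1 0 gi.2 != 0 -> VG_deg gi = b.
Proof. by split=> [Hx [g i]|Hx g i /(Hx (g, i))] //; apply: Hx. Qed.

Lemma VG_co_lin (gi : G * 'I_n) k (x y : L) : (k *: x + y) gi.1 0 gi.2 =
  k * x gi.1 0 gi.2 + y gi.1 0 gi.2.
Proof. by rewrite !ffunE !mxE. Qed.

Lemma VG_co_e (gi hj : G * 'I_n) :
  tens c (bvec hj.2) hj.1 gi.1 0 gi.2 = (gi == hj)%:R.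
Proof.
case: gi hj => [g i] [h j] /=; rewrite ffunE xpair_eqE.
by case: eqP => _; rewrite mxE.
Qed.

Lemma VG_coK (x : L) :
  x = \sum_(gi : G * 'I_n) x gi.1 0 gi.2 *: tens c (bvec gi.2) gi.1.
Proof. by rewrite {1}[x]VG_sum pair_big. Qed.

Lemma grL_grading : is_grading (grL kappa).
Proof.
exact: (@coord_grading _ _ _ _ (fun gi : G * 'I_n => tens c (bvec gi.2) gi.1)
  (fun gi x => x gi.1 0 gi.2) VG_deg VG_co_lin VG_co_e VG_coK _ grL_grE).
Qed.

Lemma grL_ind (P : L -> Prop) b : P 0 ->
  (forall k x y, P x -> P y -> P (k *: x + y)) ->
  (forall g i, dv i + dg g = b -> P (tens c (bvec i) g)) ->
  forall x, grL kappa b x -> P x.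
Proof.
move=> P0 PD Pe; apply: (@gr_ind _ _ _ _
  (fun gi : G * 'I_n => tens c (bvec gi.2) gi.1)
  (fun gi x => x gi.1 0 gi.2) VG_deg VG_coK _ grL_grE) => // -[g i].
exact: Pe.
Qed.

Lemma grL_tens b v g : grV kappa b v -> grL kappa (b + dg g) (tens c v g).
Proof.
move=> Hv h i; rewrite ffunE; case: (h =P g) => [-> /Hv -> //|_].
by rewrite mxE eqxx.
Qed.

Lemma grV_bvec i : grV kappa (dv i) (bvec i).
Proof.
by move=> j; rewrite mxE eqxx; case: (j =P i) => [-> //|_]; rewrite eqxx.
Qed.

Lemma grL_tens_bvec i g : grL kappa (dv i + dg g) (tens c (bvec i) g).
Proof. exact/grL_tens/grV_bvec. Qed.

Lemma grL_lact a b r x : grKG kappa a r -> grL kappa b x ->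
  grL kappa (a + b) (lact r x).
Proof.
have [gr0 grD _ _] := grL_grading.
move=> Hr Hx; move: r Hr; apply: grKG_ind => [|k r s Hr Hs|g <-].
- by rewrite (lin0_of (lact_linearl x)).
- by rewrite lact_linearl; exact: grD Hr Hs.
move: x Hx; apply: grL_ind => [|k y z Hy Hz|h i <-].
- by rewrite (lin0_of (lact_linearr _)).
- by rewrite lact_linearr; exact: grD Hy Hz.
rewrite lact_tens gact_bvec tensZ -[_ *: _]addr0; apply: grD => //.
rewrite addrCA -deg_gD; exact: grL_tens_bvec.
Qed.

Lemma grL_ract b d x s : grL kappa b x -> grKG kappa d s ->
  grL kappa (b + d) (ract x s).
Proof.
have [gr0 grD _ _] := grL_grading.
move=> Hx Hs; move: s Hs; apply: grKG_ind => [|k r s Hr Hs|g <-].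
- by rewrite (lin0_of (ract_linearr x)).
- by rewrite ract_linearr; exact: grD Hr Hs.
move: x Hx; apply: grL_ind => [|k y z Hy Hz|h i <-].
- by rewrite (lin0_of (ract_linearl _)).
- by rewrite ract_linearl; exact: grD Hy Hz.
rewrite ract_tens -addrA -deg_gD; exact: grL_tens_bvec.
Qed.

Lemma grL_bimodule : graded_bimodule (grKG kappa) (grL kappa).
Proof.
split=> [|a b d r x s Hr Hx Hs]; first exact: grL_grading.
by apply: grL_ract Hs; apply: grL_lact.
Qed.

Lemma bracket_linearl y : linear (br^~ y).
Proof.
case: Hkappa => kl _ _ k x x'; rewrite /bracket scaler_sumr -big_split /=.
apply: eq_bigr => g _; rewrite scaler_sumr -big_split /=.
by apply: eq_bigr => h _; rewrite !ffunE kl ract_linearl.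
Qed.

Lemma bracket_linearr x : linear (br x).
Proof.
case: Hkappa => _ kr _ k y y'; rewrite /bracket scaler_sumr -big_split /=.
apply: eq_bigr => g _; rewrite scaler_sumr -big_split /=.
by apply: eq_bigr => h _; rewrite !ffunE gact_linear kr ract_linearl.
Qed.

Lemma bracket_basis i g j h : br (tens c (bvec i) g) (tens c (bvec j) h) =
  c j g *: ract (kappa (bvec i) (bvec j)) (gelt K (g + h)).
Proof.
rewrite (bracketE _ _ _ _ Hkappa) gact_bvec; case: Hkappa => _ kr _.
by rewrite (linZ_of (kr _)) (linZ_of (ract_linearl _)).
Qed.

Lemma bracket_deg a b x y : grL kappa a x -> grL kappa b y ->
  grL kappa (a + b) (br x y).
Proof.
have [gr0 grD _ _] := grL_grading => Hx Hy.
move: x Hx; apply: grL_ind => [|k x x' Hx Hx'|g i <-].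
- by rewrite (lin0_of (bracket_linearl y)).
- by rewrite bracket_linearl; exact: grD Hx Hx'.
move: y Hy; apply: grL_ind => [|k y y' Hy Hy'|h j <-].
- by rewrite (lin0_of (bracket_linearr _)).
- by rewrite bracket_linearr; exact: grD Hy Hy'.
rewrite bracket_basis -[_ *: _]addr0 addrACA -deg_gD; apply: grD => //.
have Hk : grL kappa (dv i + dv j) (kappa (bvec i) (bvec j)).
  by move=> l r /deg_kappa.
exact: grL_ract Hk (@grKG_gelt _).
Qed.

End Bracket.

(** * The color Lie ring and its enveloping algebra *)

Section ColorLie.

Variables (K : fieldType) (n : nat) (G : finZmodType).
Variables (c : diag_action K n G) (q : 'I_n -> 'I_n -> K).
Variable kappa : 'rV[K]_n -> 'rV[K]_n -> VG c.
Hypothesis Hq : quantum_params q.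
Hypothesis Hkappa : parameter_function q kappa.
Hypothesis HPBW : quantum_Drinfeld_orbifold q kappa.
Hypothesis Hvan : strong_vanishing q kappa.

Local Notation L := (VG c).
Local Notation B := (AN kappa).
Local Notation dv := (deg_v kappa).
Local Notation dg := (deg_g kappa).
Local Notation br := (bracket kappa).
Local Notation H := (quotalg (H_rel q kappa)).
Local Notation rh g := (rhoH q kappa (gelt K g)).

Lemma vanishing_chi i j r g k : kappa (bvec i) (bvec j) g 0 r != 0 ->
  c k g = q i k * q j k * q k r.
Proof.
move=> /(Hvan k); rewrite gact_bvec => /rowP/(_ k).
by rewrite !mxE !eqxx !mulr1.
Qed.

Lemma group_bichar_N x y : N_gen kappa y -> group_bichar c q x y = 1.
Proof.
case=> i [j [r [g [nz ->]]]]; have Hb := group_bicharP c Hq.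
case: (Hb) (Hq) => _ Dr _ [q0 _ qV].
(* Strong vanishing reads chi_k(g) q_ki q_kj = q_kr; it is raised to the k-th entry of the Z^n-part
   of x and multiplied over k. *)
have chi_q : chi_pow c x.1 g * (q_pow q x.1 i * q_pow q x.1 j) = q_pow q x.1 r.
  rewrite /chi_pow /q_pow -!big_split; apply: eq_bigr => k _ /=.
  rewrite -!expfzMl (vanishing_chi k nz); congr (_ ^ _).
  rewrite (qV k i) (qV k j) -[RHS]mul1r mulrAC; congr (_ * _).
  by rewrite mulrACA !mulVf ?mul1r.
rewrite !Dr !(bicharNr Hb) !group_bichar_v group_bichar_g invrK.
(* Equivariance cancels the characters evaluated at the G-part of x; what remains is [chi_q]. *)
rewrite (kappa_chi HPBW x.2 nz) mulrACA -mulf_div divff.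
  by rewrite mulr1 mulrAC [_ * chi_pow _ _ _]mulrC chi_q divff ?q_pow_neq0.
by rewrite mulf_neq0 ?chi_neq0.
Qed.

(** The last clause is the Yetter-Drinfeld condition on basis vectors. *)
Lemma eps_exists : exists eps : B -> B -> K,
  [/\ bicharacter eps, antisymmetric_bichar eps,
      forall g h i j, eps (dv i + dg g) (dv j + dg h) =
        q i j * c j g * (c i h)^-1
    & forall g j, eps (dg g) (dv j) = c j g].
Proof.
have [eps [eb ea eE]] := quot_bicharacter (group_bicharP c Hq)
  (group_bichar_anti c Hq) group_bichar_N.
exists eps; split=> // [g h i j|g j].
  by rewrite -!subgroup_piD eE group_bichar_basis.
rewrite eE group_bichar_v /q_pow big1 ?mul1r // => i _.
by rewrite mxE expr0z.
Qed.

Variable eps : B -> B -> K.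
Hypothesis eps_bichar : bicharacter eps.
Hypothesis eps_anti : antisymmetric_bichar eps.
Hypothesis eps_basis : forall g h i j,
  eps (dv i + dg g) (dv j + dg h) = q i j * c j g * (c i h)^-1.
Hypothesis eps_act : forall g j, eps (dg g) (dv j) = c j g.

Lemma lact_ract_kappa a b i j :
  lact (gelt K a) (ract (kappa (bvec i) (bvec j)) (gelt K b)) =
  (c i a * c j a) *: ract (kappa (bvec i) (bvec j)) (gelt K (a + b)).
Proof.
rewrite -lractA (kappa_equivariant HPBW) (linZ_of (ract_linearl _)).
by rewrite -ractM geltM.
Qed.

(** On basis elements a contributes chi_i(a) through ^a v_i, and chi_j(a) because v_j is twisted by
    a + g instead of g. Moving a through kappa produces the same product by equivariance. *)
Lemma bracket_bilinear r x y s :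
  br (lact r x) (ract y s) = ract (lact r (br x y)) s.
Proof.
have bl := bracket_linearl Hkappa; have brr := bracket_linearr Hkappa.
move: x; apply: VG_linP => [k x x'|k x x'|g i].
- by rewrite lact_linearr bl.
- by rewrite bl lact_linearr ract_linearl.
move: y; apply: VG_linP => [k y y'|k y y'|h j].
- by rewrite ract_linearl brr.
- by rewrite brr lact_linearr ract_linearl.
move: r; apply: lin_extP => [k r r'|k r r'|a].
- by rewrite lact_linearl bl.
- by rewrite lact_linearl ract_linearl.
move: s; apply: lin_extP => [k s s'|k s s'|b].
- by rewrite ract_linearr brr.
- by rewrite ract_linearr.
rewrite -!/(gelt K _) lact_tens ract_tens gact_bvec tensZ (linZ_of (bl _)).
rewrite !(bracket_basis Hkappa) (linZ_of (lact_linearr _)) lact_ract_kappa.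
rewrite !(linZ_of (ract_linearl _)) -ractM geltM !scalerA chiD.
by rewrite [in LHS]mulrA [_ * c j g]mulrC !addrA.
Qed.

(** The twist of v_j by g in the bracket makes this work: on both sides v_j acquires the factor
    chi_j(g) chi_j(a). *)
Lemma bracket_balanced x r y : br (ract x r) y = br x (lact r y).
Proof.
have bl := bracket_linearl Hkappa; have brr := bracket_linearr Hkappa.
move: x; apply: VG_linP => [k x x'|k x x'|g i].
- by rewrite ract_linearl bl.
- by rewrite bl.
move: y; apply: VG_linP => [k y y'|k y y'|h j].
- by rewrite brr.
- by rewrite lact_linearr brr.
move: r; apply: lin_extP => [k r r'|k r r'|a].
- by rewrite ract_linearr bl.
- by rewrite lact_linearl brr.
rewrite -!/(gelt K _) lact_tens ract_tens gact_bvec tensZ (linZ_of (brr _)).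
by rewrite !(bracket_basis Hkappa) scalerA chiD addrA [c j a * _]mulrC.
Qed.

(** With the degrees a and b fixed, the commutator is bilinear, so basis elements suffice; there
    epsilon is the scalar of [quot_tens_commutator]. *)
Lemma piL_bracket a b x y : grL kappa a x -> grL kappa b y ->
  piL q kappa (br x y) = qcomm (eps a b) (piL q kappa x) (piL q kappa y).
Proof.
have bl := bracket_linearl Hkappa; have brr := bracket_linearr Hkappa.
have pl := piL_linear q kappa; move=> Hx Hy.
move: x Hx; apply: grL_ind => [|k x x' Hx Hx'|g i <-].
- by rewrite (lin0_of (bl _)) (lin0_of pl) (lin0_of (qcomm_linearl _ _)).
- by rewrite bl !pl qcomm_linearl Hx Hx'.
move: y Hy; apply: grL_ind => [|k y y' Hy Hy'|h j <-].
- by rewrite (lin0_of (brr _)) (lin0_of pl) (lin0_of (qcomm_linearr _ _)).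
- by rewrite brr !pl qcomm_linearr Hy Hy'.
rewrite (bracket_basis Hkappa) (linZ_of pl) piL_ract eps_basis.
rewrite (piL_tens q kappa i g) (piL_tens q kappa j h); apply/esym.
have rhD a' b' : rh a' * rh b' = rh (a' + b').
  by rewrite -geltM (rhoH_monoid q kappa).2.
exact: (quot_tens_commutator (chi_neq0 c i h)
  (rhoH_commute q kappa j g) (rhoH_commute q kappa i h) (rhD g h)
  (etrans (rhD h g) (congr1 (fun k => rh k) (addrC h g))) (H_relE q kappa i j)).
Qed.

Lemma bracket_anti a b x y : grL kappa a x -> grL kappa b y ->
  br x y = - (eps a b *: br y x).
Proof.
move=> Hx Hy; apply/eqP; rewrite -addr_eq0; apply/eqP/(piL_inj HPBW).
have pl := piL_linear q kappa; case: eps_bichar => nz _ _.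
rewrite (linD_of pl) (linZ_of pl) (piL_bracket Hx Hy) (piL_bracket Hy Hx).
by rewrite (eps_anti a b); apply: qcomm_anti (nz a b).
Qed.

Lemma bracket_jacobi a b d x y z :
  grL kappa a x -> grL kappa b y -> grL kappa d z ->
  eps d a *: br x (br y z) + eps a b *: br y (br z x)
    + eps b d *: br z (br x y) = 0.
Proof.
move=> Hx Hy Hz; apply: (piL_inj HPBW).
have pl := piL_linear q kappa; case: eps_bichar => nz Dr _.
have bd := bracket_deg Hkappa.
rewrite !(linD_of pl) !(linZ_of pl).
rewrite (piL_bracket Hx (bd _ _ _ _ Hy Hz)) (piL_bracket Hy Hz).
rewrite (piL_bracket Hy (bd _ _ _ _ Hz Hx)) (piL_bracket Hz Hx).
rewrite (piL_bracket Hz (bd _ _ _ _ Hx Hy)) (piL_bracket Hx Hy).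
rewrite !Dr (eps_anti d a) (eps_anti a b) (eps_anti b d).
by apply: quot_jacobi.
Qed.

Lemma bracket_color_Lie_ring :
  color_Lie_ring eps (grKG kappa) (grL kappa) br.
Proof.
split.
- exact: grKG_algebra.
- exact: grL_bimodule.
- exact: bracket_linearl Hkappa.
- exact: bracket_linearr Hkappa.
- exact: bracket_bilinear.
- exact: bracket_balanced.
- exact: bracket_deg Hkappa.
- exact: bracket_anti.
- exact: bracket_jacobi.
Qed.

Lemma bracket_Yetter_Drinfeld :
  Yetter_Drinfeld eps (grV kappa) dg (grKG kappa) (grL kappa) br.
Proof.
split.
- exact: bracket_color_Lie_ring.
- exact: grV_grading.
- by move=> g; apply: grKG_gelt.
- by move=> b v g; apply: grL_tens.
move=> g b v Hv; apply/rowP => i; rewrite !mxE.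
have [->|/Hv <-] := eqVneq (v 0 i) 0; first by rewrite !mulr0.
by rewrite eps_act.
Qed.

Local Notation R := (env_rel eps (grL kappa) br).
Local Notation U := (quotalg R).

Lemma env_to_H : exists f : U -> H,
  [/\ linear f, monoid_morphism f,
      forall x, f (quot_pi R (tensor_in x)) = piL q kappa x
    & forall r, f (quot_pi R (tensor_coef L r)) = rhoH q kappa r].
Proof.
exact: (universal_env_lift (piL_linear q kappa) (rhoH_linear q kappa)
  (rhoH_monoid q kappa) (piL_lact q kappa) (fun l r => piL_ract q kappa l r)
  piL_bracket).
Qed.

Lemma env_commutator a b u v : grL kappa a u -> grL kappa b v ->
  quot_pi R (tensor_in (br u v)) =
  qcomm (eps a b) (quot_pi R (tensor_in u)) (quot_pi R (tensor_in v)).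
Proof.
move=> Hu Hv; apply: (canRL (addrK _)); rewrite addrC; apply/esym.
by apply: quot_commutator; exists a, b, u, v.
Qed.

(** The enveloping relation at v_i (x) 1 and v_j (x) 1 is the defining relation of H: there the
    bracket is kappa(v_i, v_j) and epsilon is q_ij. *)
Lemma env_kappa i j : quot_pi R (tensor_in (kappa (bvec i) (bvec j))) =
  qcomm (q i j) (quot_pi R (tensor_in (tens c (bvec i) 0)))
    (quot_pi R (tensor_in (tens c (bvec j) 0))).
Proof.
have E : br (tens c (bvec i) 0) (tens c (bvec j) 0) = kappa (bvec i) (bvec j).
  by rewrite (bracket_basis Hkappa) chi0 scale1r addr0 [LHS]ract1.
have e : eps (dv i + dg 0) (dv j + dg 0) = q i j.
  by rewrite eps_basis !chi0 divr1 mulr1.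
rewrite -E -e; apply: env_commutator; exact: grL_tens_bvec.
Qed.

Lemma H_to_env : exists f : H -> U,
  [/\ linear f, monoid_morphism f,
      forall x, f (piL q kappa x) = quot_pi R (tensor_in x)
    & forall r, f (rhoH q kappa r) = quot_pi R (tensor_coef L r)].
Proof.
have lp : linear (fun x : L => quot_pi R (tensor_in x)).
  by move=> k x y; rewrite tensor_in_linear quot_pi_linear.
have lr : linear (fun r => quot_pi R (tensor_coef L r)).
  by move=> k r s; rewrite tensor_coef_linear quot_pi_linear.
apply: (orbifold_lift lp lr) => [|r x|x r|i j].
- split=> [|r s]; first by rewrite (tensor_coef_monoid L).1.
  by rewrite (tensor_coef_monoid L).2 (quot_pi_monoid R).2.
- by rewrite tensor_in_lact (quot_pi_monoid R).2.
- by rewrite tensor_in_ract (quot_pi_monoid R).2.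
exact: env_kappa.
Qed.

Lemma env_isomorphism : exists f : U -> H,
  [/\ linear f, monoid_morphism f & bijective f].
Proof.
have [f [lf mf fp fr]] := env_to_H; have [g [lg mg gp gr]] := H_to_env.
exists f; split=> //; exists g => x; rewrite -[x]quot_piK; move: (repr x) => {}x.
  (* Both composites are compared with the identity after precomposing with the quotient map,
     because the uniqueness statements concern maps out of T_R(L) and of the skew group algebra. *)
  apply: (@tensor_algP _ _ _ _ R (fun x => g (f (quot_pi R x))) (quot_pi R)).
  - by move=> k y z; rewrite quot_pi_linear lf lg.
  - split=> [|y z]; first exact: etrans (congr1 g mf.1) mg.1.
    by rewrite (quot_pi_monoid R).2 mf.2 mg.2.
  - exact: quot_pi_linear.
  - exact: quot_pi_monoid.
  - by move=> l; rewrite fp gp.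
  - by move=> r; rewrite fr gr.
set piH := quot_pi (H_rel q kappa).
apply: (@skew_algP _ _ _ _ _ _ (fun x => f (g (piH x))) piH).
- by move=> k y z; rewrite /piH quot_pi_linear lg lf.
- split=> [|y z]; first exact: etrans (congr1 f mg.1) mf.1.
  by rewrite [piH _](quot_pi_monoid _).2 mg.2 mf.2.
- exact: quot_pi_linear.
- exact: quot_pi_monoid.
- move=> i; have := fp (tens c (bvec i) 0).
  by rewrite -gp /piL VG_in_tens.
- by move=> h; have := fr (gelt K h); rewrite -gr rhoH_gelt.
Qed.

End ColorLie.

Theorem theorem5p2 (K : fieldType) (charK : [pchar K] =i pred0)
  (n : nat) (n_gt0 : (0 < n)%N) (G : finZmodType)
  (chi : diag_action K n G) (q : 'I_n -> 'I_n -> K)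
  (kappa : 'rV[K]_n -> 'rV[K]_n -> VG chi)
  (Hq : quantum_params q) (Hkappa : parameter_function q kappa)
  (HPBW : quantum_Drinfeld_orbifold q kappa)
  (Hvan : strong_vanishing q kappa) :
  exists eps : AN kappa -> AN kappa -> K,
    [/\ (* (a) *)
        [/\ bicharacter eps, antisymmetric_bichar eps
          & forall (g h : G) (i j : 'I_n),
              eps (deg_v kappa i + deg_g kappa g) (deg_v kappa j + deg_g kappa h)
              = q i j * chi j g * (chi i h)^-1],
        (* (b) *)
        [/\ is_grading (grL kappa),
            (forall y, linear ((bracket kappa)^~ y)),
            (forall x, linear (bracket kappa x))
          & forall (a b : AN kappa) (x y : VG chi),
              grL kappa a x -> grL kappa b y -> grL kappa (a + b) (bracket kappa x y)],
        (* (c) *)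
        Yetter_Drinfeld eps (grV kappa) (deg_g kappa)
          (grKG kappa) (grL kappa) (bracket kappa)
      & exists f : universal_env eps (grL kappa) (bracket kappa)
                     -> H_alg q kappa,
          [/\ linear f, monoid_morphism f & bijective f] ].
Proof.
have [eps [eps_bi eps_anti eps_E eps_act]] := eps_exists Hq HPBW Hvan.
exists eps; split.
- by split=> // g h i j; apply: eps_E.
- split; [exact: grL_grading | exact: bracket_linearl Hkappa
    | exact: bracket_linearr Hkappa | exact: bracket_deg Hkappa].
- exact: (bracket_Yetter_Drinfeld Hkappa HPBW eps_bi eps_anti eps_E eps_act).
- exact: (env_isomorphism Hkappa eps_E).
Qed.
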